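(* Let $c\in\{0,N\}$ and let $[x_k]=(x_0,x_1,\ldots,x_N)$ be a zero-mean nonsingular Gaussian sequence of $\mathbb{R}^d$-valued random vectors with covariance function $C_{k_1,k_2}$. Then $[x_k]$ is $CM_c$ if and only if it obeys a model of the form $$x_k=G_{k,k-1}x_{k-1}+G_{k,c}x_c+e_k,\qquad k\in[1,N]\setminus\{c\},$$ $$x_c=e_c,\qquad\text{and, if } c=N,\quad x_0=G_{0,N}x_N+e_0,$$ for some $d\times d$ matrices $G_{k,k-1}$, $G_{k,c}$ (and $G_{0,N}$ if $c=N$), where $[e_k]=(e_0,\ldots,e_N)$ is a zero-mean white nonsingular Gaussian sequence with covariances $\operatorname{Cov}(e_k)=G_k$.
   Context: All random vectors are defined on a common probability space $(\Omega,\mathcal{A},P)$. Notation: $[i,j]=\{i,i+1,\ldots,j\}$, $[x_k]_i^j=\{x_k: k\in[i,j]\}$ (empty if $i>j$), $[x_k]=[x_k]_0^N$, and $\sigma(\cdot)$ is the generated $\sigma$-field. $CM_c$: for $c\in\{0,N\}$, a sequence $[x_k]$ is $CM_c$ if for every $j\in[0,N]$, every $A\in\sigma([x_k]_{j+1}^N\setminus\{x_c\})$ and every $B\in\sigma([x_k]_0^{j-1}\setminus\{x_c\})$, $$P\{A\cap B\mid x_j,x_c\}=P\{A\mid x_j,x_c\}\,P\{B\mid x_j,x_c\}\quad\text{a.s.}$$ Here $[x_k]_a^b\setminus\{x_c\}$ means the subsequence with the index $c$ removed. Gaussian sequence: $x_0,\ldots,x_N$ are jointly Gaussian; nonsingular: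 the covariance matrix of the stacked vector $(x_0',\ldots,x_N')'$ is nonsingular. Covariance function: $C_{k_1,k_2}=\operatorname{Cov}(x_{k_1},x_{k_2})$. A sequence $[e_k]$ is zero-mean white nonsingular Gaussian with covariances $G_k$ if $e_0,\ldots,e_N$ are jointly Gaussian with mean zero, $E[e_ke_j']=0$ for $k\ne j$, and $E[e_ke_k']=G_k$ is nonsingular for every $k\in[0,N]$. Convention: when $c=0$ and $k=1$, the two coefficients $G_{k,k-1}$ and $G_{k,c}$ are the same matrix $G_{1,0}$, so the equation reads $x_1=2G_{1,0}x_0+e_1$. *)

(* Defs.v *)
From HB Require Import structures.
From mathcomp Require Export all_boot all_order all_algebra.
From mathcomp Require Export all_classical all_reals all_analysis.

Set Implicit Arguments.
Unset Strict Implicit.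
Unset Printing Implicit Defensive.

Import Order.TTheory GRing.Theory Num.Theory.
Import numFieldNormedType.Exports.

Local Open Scope classical_set_scope.
Local Open Scope ring_scope.

Section RandomVectors.
Context {disp : measure_display} {T : measurableType disp} {R : realType}.
Variable P : probability T R.

(* [s] is the standard deviation.  The library's [normal_prob m 0] is not the
   point mass at [m], so the degenerate case is spelled out. *)
Definition gaussian_law (m s : R) (B : set R) : \bar R :=
  if s == 0 then \d_m B else normal_prob m s B.

Definition gaussian_rv (X : T -> R) : Prop :=
  measurable_fun setT X /\
  exists m s : R,
    forall B : set R, measurable B -> P (X @^-1` B) = gaussian_law m s B.

Definition gaussian_vector (n : nat) (X : T -> 'cV[R]_n) : Prop :=
  forall a : 'rV[R]_n, gaussian_rv (fun w => (a *m X w) 0 0).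

(* [fine] is harmless in the next two definitions when the random vectors are
   jointly Gaussian, because all the moments involved are then finite. *)
Definition expect_mx (m n : nat) (X : T -> 'M[R]_(m, n)) : 'M[R]_(m, n) :=
  \matrix_(i, j) fine 'E_P[fun w => X w i j]%E.

Definition cov_mx (m n : nat) (X : T -> 'cV[R]_m) (Y : T -> 'cV[R]_n) :
    'M[R]_(m, n) :=
  \matrix_(i, j) fine (covariance P (fun w => X w i 0) (fun w => Y w j 0)).

(* A sequence x_0, ..., x_N of R^d-valued maps is a function on 'I_N.+1. *)

Definition stack (N d : nat) (x : 'I_N.+1 -> T -> 'cV[R]_d) (w : T) :
    'cV[R]_(\sum_(k < N.+1) d) :=
  \mxcol_(k < N.+1) x k w.

Definition gaussian_seq (N d : nat) (x : 'I_N.+1 -> T -> 'cV[R]_d) : Prop :=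
  gaussian_vector (stack x).

Definition nonsingular_seq (N d : nat) (x : 'I_N.+1 -> T -> 'cV[R]_d) : Prop :=
  cov_mx (stack x) (stack x) \in unitmx.

Definition zero_mean_seq (N d : nat) (x : 'I_N.+1 -> T -> 'cV[R]_d) : Prop :=
  forall k, expect_mx (x k) = 0.

Definition white_gaussian_seq (N d : nat) (Q : 'I_N.+1 -> 'M[R]_d)
    (e : 'I_N.+1 -> T -> 'cV[R]_d) : Prop :=
  [/\ gaussian_seq e,
      zero_mean_seq e,
      forall k j, k != j -> expect_mx (fun w => e k w *m (e j w)^T) = 0,
      forall k, expect_mx (fun w => e k w *m (e k w)^T) = Q k
    & forall k, Q k \in unitmx].

(* The Borel sigma-field of R^d is generated by the coordinate maps, hence the
   sigma-field of (x_k, k in K) is generated by the coordinates of the x_k; it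
   is {set0, setT} when K is empty. *)
Definition sigma_seq (N d : nat) (x : 'I_N.+1 -> T -> 'cV[R]_d)
    (K : set 'I_N.+1) : set (set T) :=
  <<s [set A | exists k (i : 'I_d) (B : set R),
        [/\ K k, measurable B & A = (fun w => x k w i 0) @^-1` B]] >>.

(* [f] is a version of the conditional probability of [A] given [G]. *)
Definition is_cond_prob (G : set (set T)) (A : set T) (f : T -> R) : Prop :=
  [/\ forall B : set R, measurable B -> G (f @^-1` B),
      P.-integrable setT (EFin \o f)
    & forall B, G B -> (\int[P]_(w in B) (f w)%:E = P (A `&` B))%E].

(* Versions of conditional probabilities always exist and are almost surely
   unique, so which versions are compared is immaterial. *)
Definition cond_indep (G : set (set T)) (A B : set T) : Prop :=
  exists f g h : T -> R,
    [/\ is_cond_prob G A f, is_cond_prob G B g, is_cond_prob G (A `&` B) h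
      & {ae P, forall w, h w = f w * g w}].

Definition CM (N d : nat) (c : 'I_N.+1) (x : 'I_N.+1 -> T -> 'cV[R]_d) : Prop :=
  forall (j : 'I_N.+1) (A B : set T),
    sigma_seq x [set k : 'I_N.+1 | (j < k)%N /\ k <> c] A ->
    sigma_seq x [set k : 'I_N.+1 | (k < j)%N /\ k <> c] B ->
    cond_indep (sigma_seq x [set j; c]) A B.

(* In the first clause [j] plays the role of k - 1, so that k ranges over
   [1, N] \ {c}.  When c = 0 and k = 1 the two coefficients are the same
   matrix G_{1,0}. *)
Definition CM_model (N d : nat) (c : 'I_N.+1)
    (G : 'I_N.+1 -> 'I_N.+1 -> 'M[R]_d)
    (x e : 'I_N.+1 -> T -> 'cV[R]_d) : Prop :=
  [/\ forall k j : 'I_N.+1, k = j.+1 :> nat -> k != c ->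
        forall w, x k w = G k j *m x j w + G k c *m x c w + e k w,
      forall w, x c w = e c w
    & c = ord_max ->
        forall w, x ord0 w = G ord0 ord_max *m x ord_max w + e ord0 w].

End RandomVectors.

(* Main.v *)
(** Both sides of the equivalence say that, for l < j < k with k, l <> c, the
    residual of x_l on its L^2 projection onto the span of (x_j, x_c) is
    orthogonal to x_k.  Passing between this and the model is linear algebra
    (e_k is the residual of x_k on (x_{k-1}, x_c)).  Passing between this and
    conditional independence rests on two facts.
    First, a centered Gaussian L satisfies E cos(L + t) = cos t exp(- E L^2 / 2),
    by Stein's identity, so orthogonality inside a Gaussian family factorizes
    the expectations of characters.
    Second, if psi is integrable and E[psi cos(L + t)] = 0 for all L in a linear
    family and all t, then E[psi 1_D] = 0 for every D in the sigma-field generated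
    by the family.  Indeed psi is then orthogonal to the algebra of trigonometric
    polynomials, hence to the indicators of the sets {g > 0}, g in the algebra,
    which are bounded limits of iterated polynomials in g; these sets form a
    generating pi-system up to intersections.
    If W = Y + Z with Y in the span of (x_j, x_c) and Z orthogonal to the present
    and the future, then E[cos(W + t) | present, future] is a multiple of
    cos(Y + t), so P(A | x_j, x_c) also serves as P(A | past, x_j, x_c) for A in
    the future; this is conditional independence.  Conversely, if s is the
    residual of x_l, then E[1_A s] = E[P(A | x_j, x_c) s] = 0 for A in
    sigma(x_k), because s is independent of (x_j, x_c); hence E[x_k s] = 0. *)

Require Import Defs.
From mathcomp Require Import finmap ring lra measurable_realfun.

Set Implicit Arguments.
Unset Strict Implicit.
Unset Printing Implicit Defensive.
Import Order.TTheory GRing.Theory Num.Theory.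
Import numFieldNormedType.Exports.
Import HBNNSimple.

Local Open Scope classical_set_scope.
Local Open Scope ring_scope.

(** * Vanishing integrals *)

Section Integrals.
Context d (T : measurableType d) (R : realType) (P : probability T R).
Implicit Types (f g psi Y : T -> R) (D : set T).

Definition bounded_rv g := measurable_fun setT g /\ exists M, forall w, `|g w| <= M.

Lemma bounded_rv_indic D : measurable D -> bounded_rv (\1_D : T -> R).
Proof.
move=> mD; split; first exact: measurable_indic.
by exists 1 => w; rewrite indicE ger0_norm ?ler0n// lern1 leq_b1.
Qed.

Lemma bounded_rv_cst (r : R) : bounded_rv (fun=> r).
Proof. by split; [exact: measurable_cst|exists `|r|]. Qed.

Lemma bounded_rvM f g : bounded_rv f -> bounded_rv g ->
  bounded_rv (fun w => f w * g w).
Proof.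
move=> [mf [M fM]] [mg [N gN]]; split; first exact: measurable_funM.
by exists (M * N) => w; rewrite normrM ler_pM.
Qed.

Lemma bounded_rvD f g : bounded_rv f -> bounded_rv g ->
  bounded_rv (fun w => f w + g w).
Proof.
move=> [mf [M fM]] [mg [N gN]]; split; first exact: measurable_funD.
by exists (M + N) => w; rewrite (le_trans (ler_normD _ _))// lerD.
Qed.

Lemma integrable_mul_bounded psi g : P.-integrable setT (EFin \o psi) ->
  bounded_rv g -> P.-integrable setT (EFin \o (fun w => psi w * g w)).
Proof.
move=> ipsi [mg [M gM]].
have -> : EFin \o (fun w => psi w * g w) = ((EFin \o psi) \* (EFin \o g))%E by [].
apply: integrableMl => //; exists M; split; first exact: num_real.
by move=> x Mx w _; rewrite /= (le_trans (gM w))// ltW.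
Qed.

Lemma integrable_bounded g : bounded_rv g -> P.-integrable setT (EFin \o g).
Proof.
move=> bg; have := @integrable_mul_bounded (cst 1) g.
have -> : (fun w => cst 1 w * g w) = g by apply/funext => w; rewrite /= mul1r.
by apply=> //; apply: finite_measure_integrable_cst.
Qed.

Lemma Rintegral_sum I (r : seq I) (F : I -> T -> R) :
  (forall i, P.-integrable setT (EFin \o F i)) ->
  \int[P]_w (\sum_(i <- r) F i w) = \sum_(i <- r) \int[P]_w F i w.
Proof.
move=> iF; elim: r => [|i r IH].
  under eq_Rintegral do rewrite big_nil.
  by rewrite big_nil Rintegral_cst// mul0r.
under eq_Rintegral do rewrite big_cons.
rewrite big_cons -IH RintegralD//.
have -> : EFin \o (fun w => \sum_(j <- r) F j w) =
    (fun w => \sum_(j <- r) (EFin \o F j) w)%E.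
  by apply/funext => w /=; rewrite sumEFin.
exact: integrable_sum.
Qed.

Lemma Rintegral0_dominated (f_ : nat -> T -> R) f (G : T -> R) :
  (forall n, measurable_fun setT (f_ n)) -> measurable_fun setT f ->
  (forall w, f_ n w @[n --> \oo] --> f w) ->
  P.-integrable setT (EFin \o G) -> (forall n w, `|f_ n w| <= G w) ->
  (forall n, \int[P]_w f_ n w = 0) -> \int[P]_w f w = 0.
Proof.
move=> mf_ mf cf iG fG f0.
have emf_ n : measurable_fun setT (EFin \o f_ n) by exact/measurable_EFinP.
have emf : measurable_fun setT (EFin \o f) by exact/measurable_EFinP.
have ecf : {ae P, forall w, setT w -> (EFin \o f_ n) w @[n --> \oo] --> (EFin \o f) w}.
  by apply/aeW => w _; apply: cvg_EFin; [exact: nearW|exact: cf].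
have eG : {ae P, forall w n, setT w -> (`|(EFin \o f_ n) w| <= (EFin \o G) w)%E}.
  by apply/aeW => w n _; rewrite /= lee_fin.
have [_ _] := dominated_convergence measurableT emf_ emf ecf iG eG.
have -> : (fun n => \int[P]_(x in setT) (EFin \o f_ n) x)%E = fun=> 0%E.
  apply/funext => n.
  rewrite -[LHS]fineK; first by rewrite [fine _]f0.
  apply: integrable_fin_num => //; apply: le_integrable iG => //.
  by move=> w _; rewrite /= lee_fin (le_trans (fG n w))// ler_norm.
by rewrite /Rintegral => /cvg_lim <- //; rewrite lim_cst.
Qed.

(** The sets over which [psi] integrates to zero form a Dynkin system: [psi0] supplies the whole
    space, and the charge induced by [psi] supplies countable additivity. *)
Lemma Rintegral0_dynkin psi (G : set (set T)) :
  P.-integrable setT (EFin \o psi) -> setI_closed G ->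
  (forall D, G D -> measurable D) -> \int[P]_w psi w = 0 ->
  (forall D, G D -> \int[P]_w (psi w * \1_D w) = 0) ->
  forall D, <<s G >> D -> \int[P]_w (psi w * \1_D w) = 0.
Proof.
move=> ipsi GI mG psi0 psiG D sD.
(* [fine] sends infinities to 0, so the passage from the real integral back to the charge goes
   through integrability. *)
have H E : measurable E ->
    \int[P]_w (psi w * \1_E w) = 0 <-> induced_charge ipsi E = 0%E.
  move=> mE; rewrite /induced_charge.
  have -> : (\int[P]_(t in E) (EFin \o psi) t = \int[P]_t (psi t * \1_E t)%:E)%E.
    rewrite integral_mkcond restrict_EFin patch_indic.
    by apply: eq_integral => w _.
  split=> [/eqP|E0]; last by rewrite /Rintegral E0.
  rewrite /Rintegral fine_eq0; first by move/eqP.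
  by apply: integrable_fin_num => //; apply: integrable_mul_bounded => //;
    exact: bounded_rv_indic.
suff : <<d G>> D -> measurable D /\ induced_charge ipsi D = 0%E.
  by rewrite setI_closed_g_dynkin_g_sigma_algebra// => /(_ sD)[mD] /(H _ mD).
move=> /(_ [set D | measurable D /\ induced_charge ipsi D = 0%E]); apply; split.
  split.
  - split=> //; apply/H => //; rewrite -[RHS]psi0; apply: eq_Rintegral => w _.
    by rewrite indicT mulr1.
  - move=> E [mE E0]; split; first exact: measurableC.
    apply/(H _ (measurableC mE)); move/(H _ mE) : E0 => E0.
    have : \int[P]_w (psi w - psi w * \1_E w) = 0.
      rewrite RintegralB ?psi0 ?E0 ?subr0//.
      by apply: integrable_mul_bounded => //; exact: bounded_rv_indic.
    move=> <-; apply: eq_Rintegral => w _.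
    by rewrite !indicE in_setC; case: (w \in E); rewrite /= ?mulr0 ?mulr1 ?subrr ?subr0.
  - move=> F tF mF; split; first by apply: bigcup_measurable => k _; case: (mF k).
    have := @charge_semi_sigma_additive _ _ _ (induced_charge ipsi) F.
    move/(_ (fun n => (mF n).1) tF) => cF.
    have /cF : measurable (\bigcup_n F n).
      by apply: bigcup_measurable => k _; case: (mF k).
    have -> : (fun n => \sum_(0 <= i < n) induced_charge ipsi (F i))%E = fun=> 0%E.
      by apply/funext => n; rewrite big1 // => i _; case: (mF i).
    by move/cvg_lim => <- //; rewrite lim_cst.
by move=> E GE; split; [exact: mG|apply/(H _ (mG _ GE)); exact: psiG].
Qed.

(* Simple functions of [Y] approximate [Y^+] and [Y^-]. *)
Lemma Rintegral0_mul psi Y : P.-integrable setT (EFin \o psi) ->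
  measurable_fun setT Y -> P.-integrable setT (EFin \o (fun w => psi w * Y w)) ->
  (forall B : set R, measurable B -> \int[P]_w (psi w * \1_(Y @^-1` B) w) = 0) ->
  \int[P]_w (psi w * Y w) = 0.
Proof.
move=> ipsi mY ipsiY psi0.
have mpsi : measurable_fun setT psi by exact/measurable_EFinP/(measurable_int P).
(* [F] will be the positive and then the negative part; [F y <= |y|] lets [|psi * Y|] dominate all
   the approximations. *)
have key (F : R -> R) : measurable_fun setT F -> (forall y, 0 <= F y <= `|y|) ->
    P.-integrable setT (EFin \o (fun w => psi w * F (Y w))) /\
    \int[P]_w (psi w * F (Y w)) = 0.
  move=> mF F0; have mF' : measurable_fun setT (EFin \o F) by exact/measurable_EFinP.
  have mFY : measurable_fun setT (fun w => psi w * F (Y w)).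
    by apply: measurable_funM => //; exact: measurableT_comp.
  split.
    apply: le_integrable ipsiY => //; first exact/measurable_EFinP.
    move=> w _; rewrite /= lee_fin !normrM ler_wpM2l//.
    by have /andP[h0] := F0 (Y w); rewrite [X in _ -> X <= _]ger0_norm.
  pose h := nnsfun_approx measurableT mF'.
  have ch y : h n y @[n --> \oo] --> F y.
    have /fine_cvgP[//] : (EFin \o h^~ y) n @[n --> \oo] --> (EFin \o F) y.
    apply: (cvg_nnsfun_approx measurableT mF') => // z _.
    by rewrite /= lee_fin; case/andP: (F0 z).
  have hF n y : 0 <= h n y <= F y.
    have h0 : 0 <= h n y by [].
    rewrite h0 /=; have /cvg_lim <- // := ch y.
    apply: (@nondecreasing_cvgn_le _ (h ^~ y)).
      by move=> i k ik; exact: (lefP _ _ (nd_nnsfun_approx measurableT mF' ik)).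
    by apply/cvg_ex; exists (F y); exact: ch.
  apply: (@Rintegral0_dominated (fun n w => psi w * h n (Y w)) _
            (fun w => `|psi w * Y w|)) => //.
  - by move=> n; apply: measurable_funM => //; exact: measurableT_comp.
  - by move=> w; apply: cvgMr; exact: ch.
  - exact: (integrable_abse ipsiY).
  - move=> n w; rewrite !normrM ler_wpM2l//.
    have /andP[h0 hle] := hF n (Y w); have /andP[_] := F0 (Y w).
    by rewrite [X in _ -> X <= _]ger0_norm//; exact: le_trans.
  - move=> n; pose s : seq R := fset_set (range (h n)).
    have mhY r : measurable (Y @^-1` (h n @^-1` [set r])).
      rewrite -[X in measurable X]setTI; apply: mY => //.
    pose g i w := psi w * (s`_i * \1_(Y @^-1` (h n @^-1` [set s`_i])) w).
    (* A simple function is a finite combination of indicators of level sets, and [psi0] applies to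
       their preimages under [Y]. *)
    transitivity (\int[P]_w (\sum_(i < #|` fset_set (range (h n))|) g i w)).
      by apply: eq_Rintegral => w _; rewrite (fimfunEord (h n)) mulr_sumr.
    rewrite (Rintegral_sum _ (F := fun i : 'I_#|` fset_set (range (h n))| => g i)).
      rewrite big1// => i _.
      rewrite /g; under eq_Rintegral do rewrite mulrCA.
      rewrite RintegralZl// ?psi0 ?mulr0//.
      by apply: integrable_mul_bounded => //; exact: bounded_rv_indic.
    move=> i; apply: integrable_mul_bounded => //; apply: bounded_rvM.
      exact: bounded_rv_cst.
    exact: bounded_rv_indic.
have mmax (F : R -> R) : measurable_fun setT F -> measurable_fun setT (fun y => Num.max (F y) 0).
  by move=> mF; exact: measurable_funrpos.
have [|y|ip ep] := key (fun y => Num.max y 0).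
- exact: mmax.
- by rewrite le_max lexx orbT /= ge_max ler_norm normr_ge0.
have [|y|iN eN] := key (fun y => Num.max (- y) 0).
- by apply: mmax; exact: oppr_measurable.
- by rewrite le_max lexx orbT /= ge_max -normrN ler_norm normr_ge0.
have -> : \int[P]_w (psi w * Y w) =
    \int[P]_w (psi w * Num.max (Y w) 0 - psi w * Num.max (- Y w) 0).
  apply: eq_Rintegral => w _; rewrite -mulrBr; congr (_ * _).
  by case: (lerP (Y w) 0) => h; [rewrite max_l ?oppr_ge0// sub0r opprK|
    rewrite max_r ?subr0// oppr_le0 ltW].
by rewrite RintegralB// ep eN subrr.
Qed.

End Integrals.

(** * Trigonometric polynomials determine the generated sigma-field *)

Section SignApproximation.
Variable R : realType.
Implicit Types u : R.

(* The iterates of [sgstep] converge to the sign function on [-1, 1]; since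
   [sgstep] is a polynomial they stay in any algebra of functions. *)
Definition sgstep u : R := (3 * u - u ^+ 3) / 2.

Lemma sgstepN u : sgstep (- u) = - sgstep u.
Proof. by rewrite /sgstep; field. Qed.

Lemma iter_sgstepN n u : iter n sgstep (- u) = - iter n sgstep u.
Proof. by elim: n => //= n ->; rewrite sgstepN. Qed.

(** Both bounds come from [1 + sgstep v = (1 + v)^2 (2 - v) / 2] and its mirror image under
    [v -> - v]. *)
Lemma normr_iter_sgstep n u : `|u| <= 1 -> `|iter n sgstep u| <= 1.
Proof.
move=> u1; elim: n => //= n; set v := iter n _ _.
rewrite !ler_norml => /andP[v1 v2]; rewrite /sgstep; apply/andP; split.
  suff : 0 <= (1 + v) ^+ 2 * (2 - v) by rewrite !exprS expr0; lra.
  by apply: mulr_ge0; [exact: sqr_ge0|lra].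
suff : 0 <= (1 - v) ^+ 2 * (2 + v) by rewrite !exprS expr0; lra.
by apply: mulr_ge0; [exact: sqr_ge0|lra].
Qed.

(** [1 - sgstep v] is [1 - v] times [1 - v / 2 - v^2 / 2], and the iterates stay above [u], so each
    step contracts the distance to 1 by a factor of at most [1 - u / 2]. *)
Lemma iter_sgstep_ge n u : 0 <= u <= 1 ->
  u <= iter n sgstep u <= 1 /\ 1 - iter n sgstep u <= (1 - u / 2) ^+ n.
Proof.
move=> /andP[u0 u1]; elim: n => [|n [/andP[v1 v2] v3]].
  by rewrite /= lexx u1 expr0; split=> //; lra.
rewrite /= exprSr; set v := iter n sgstep u in v1 v2 v3 *; rewrite /sgstep.
have e1 : 1 - (3 * v - v ^+ 3) / 2 = (1 - v) * ((1 - v) * (2 + v) / 2) by field.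
have vv : 0 <= v * (1 - v) by apply: mulr_ge0; lra.
have h1 : 1 - (3 * v - v ^+ 3) / 2 <= (1 - u / 2) ^+ n * (1 - u / 2).
  rewrite e1; apply: ler_pM => //; first lra.
    by apply: mulr_ge0; [apply: mulr_ge0|]; lra.
  by have := mulr_ge0 (le_trans u0 v1) (le_trans u0 v1); lra.
split=> //; apply/andP; split.
  suff : 0 <= v * (1 - v) * (1 + v) by rewrite !exprS expr0; lra.
  by apply: mulr_ge0 => //; lra.
suff : 0 <= (1 - v) ^+ 2 * (2 + v) by rewrite !exprS expr0; lra.
by apply: mulr_ge0; [exact: sqr_ge0|lra].
Qed.

Lemma cvg_iter_sgstep1 u : 0 < u <= 1 -> iter n sgstep u @[n --> \oo] --> (1 : R).
Proof.
move=> /andP[u0 u1].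
have c : 1 - (1 - u / 2) ^+ n @[n --> \oo] --> (1 : R).
  rewrite -[X in _ --> X]subr0; apply: cvgB; first exact: cvg_cst.
  by apply: cvg_expr; rewrite ger0_norm; lra.
apply: (squeeze_cvgr _ c (cvg_cst _)); apply: nearW => n.
have [|/andP[_ h1] h2] := @iter_sgstep_ge n u; first by rewrite (ltW u0).
by rewrite h1 andbT; lra.
Qed.

(** [(s^2 + s) / 2] maps the values -1, 0, 1 of the sign to 0, 0, 1, which turns the limit into the
    indicator of positivity. *)
Lemma cvg_iter_sgstep u : `|u| <= 1 ->
  (iter n sgstep u ^+ 2 + iter n sgstep u) / 2 @[n --> \oo] --> ((0 < u)%R%:R : R).
Proof.
move=> u1; have -> : (0 < u)%R%:R = (Num.sg u ^+ 2 + Num.sg u) / 2 :> R.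
  by case: sgrP => _; rewrite ?expr0n /= ?expr1n ?sqrrN ?addr0 ?subrr ?mul0r //; field.
suff c : iter n sgstep u @[n --> \oo] --> Num.sg u.
  apply: cvgM; last exact: cvg_cst.
  by apply: cvgD => //; rewrite expr2; apply: cvgM.
move: u1; rewrite ler_norml => /andP[u1 u2]; case: sgrP => [->|u0|u0].
- rewrite (_ : (fun n => iter n sgstep 0) = fun=> 0); first exact: cvg_cst.
  by apply/funext; elim=> //= n ->; rewrite /sgstep; field.
- by apply: cvg_iter_sgstep1; rewrite u0.
- rewrite (_ : (fun n => iter n sgstep u) = fun n => - iter n sgstep (- u)).
    by apply: cvgN; apply: cvg_iter_sgstep1; rewrite oppr_gt0 u0 /=; lra.
  by apply/funext => n; rewrite iter_sgstepN opprK.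
Qed.

End SignApproximation.

(** * From orthogonality to characters to orthogonality to events *)

Section TrigonometricUniqueness.
Context d (T : measurableType d) (R : realType) (P : probability T R).
Implicit Types (f g psi : T -> R) (A Lam : set (T -> R)) (D : set T).

(** Uniformly bounded pointwise limits of elements of [A] stay orthogonal to [psi] by dominated
    convergence. The sets [Pi] whose indicators are such limits are stable under intersection
    because [A] is stable under products. *)
Lemma Rintegral0_algebra A psi :
  P.-integrable setT (EFin \o psi) ->
  A (fun=> 1) -> (forall c g, A g -> A (fun w => c * g w)) ->
  (forall f g, A f -> A g -> A (fun w => f w + g w)) ->
  (forall f g, A f -> A g -> A (fun w => f w * g w)) ->
  (forall g, A g -> bounded_rv g) ->
  (forall g, A g -> \int[P]_w (psi w * g w) = 0) ->
  forall D, <<s [set D | exists g c, A g /\ D = [set w | c < g w]] >> D ->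
  \int[P]_w (psi w * \1_D w) = 0.
Proof.
move=> ipsi A1 AZ AD AM Ab psiA D sD.
pose Pi := [set D | measurable D /\ exists M (g_ : nat -> T -> R),
  [/\ forall n, A (g_ n), forall n w, `|g_ n w| <= M
    & forall w, g_ n w @[n --> \oo] --> (\1_D w : R)]].
have : <<s Pi >> D.
  apply: sub_sigma_algebra2 sD => _ [g [c [Ag ->]]].
  have [mg [M0 gM0]] := Ab g Ag.
  split.
    rewrite (_ : [set _ | _] = g @^-1` `]c, +oo[%classic).
      by rewrite -[X in measurable X]setTI; apply: mg.
    by apply/seteqP; split=> w /=; rewrite in_itv /= andbT.
  (* Division by [M] brings [g - c] into [[-1, 1]], where the iterates of [sgstep] converge; the
     added 1 keeps [M] positive. *)
  pose M := M0 + `|c| + 1.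
  have M_gt0 w : `|g w - c| < M.
    by rewrite /M ltr_pwDr// (le_trans (ler_normB _ _))// lerD2r.
  have M0' : 0 < M := le_lt_trans (normr_ge0 _) (M_gt0 point).
  pose u w := M^-1 * (g w - c).
  have u1 w : `|u w| <= 1.
    by rewrite normrM gtr0_norm ?invr_gt0// mulrC ler_pdivrMr// mul1r ltW.
  have Au : A u.
    have -> : u = fun w => M^-1 * (g w + - c * 1).
      by apply/funext => w; rewrite mulr1.
    by apply/AZ/AD => //; exact/AZ.
  have Ait n : A (fun w => iter n (@sgstep R) (u w)).
    elim: n => //= n IH; set v := (fun w => iter n (@sgstep R) (u w)) in IH *.
    have -> : (fun w => sgstep (iter n (@sgstep R) (u w))) =
        fun w => (3 / 2) * v w + (- 2^-1) * (v w * (v w * v w)).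
      by apply/funext => w; rewrite /sgstep -/(v w); field.
    apply/AD; first exact/AZ.
    by apply/AZ/AM => //; exact/AM.
  exists 1, (fun n w => (iter n (@sgstep R) (u w) ^+ 2 + iter n (@sgstep R) (u w)) / 2).
  split.
  - move=> n; set v := (fun w => iter n (@sgstep R) (u w)); have Av : A v := Ait n.
    have -> : (fun w => (iter n (@sgstep R) (u w) ^+ 2 + iter n (@sgstep R) (u w)) / 2) =
       fun w => 2^-1 * (v w * v w + v w).
      by apply/funext => w; rewrite -/(v w) expr2 mulrC.
    by apply/AZ/AD => //; exact/AM.
  - move=> n w; have := normr_iter_sgstep n (u1 w); set v := iter _ _ _.
    rewrite !ler_norml => /andP[v1 v2].
    have v3 : 0 <= (1 - v) * (1 + v) by apply: mulr_ge0; lra.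
    have v4 : 0 <= v ^+ 2 by exact: sqr_ge0.
    by apply/andP; split; rewrite expr2 in v4 *; lra.
  - move=> w; have := cvg_iter_sgstep (u1 w).
    rewrite indicE; congr (_ --> _); congr (_%:R).
    rewrite /u pmulr_rgt0 ?invr_gt0// subr_gt0; congr nat_of_bool.
    by apply/idP/idP; [move=> h; exact/mem_set|move/set_mem].
have A1' := psiA _ A1.
apply: Rintegral0_dynkin => //.
- move=> D1 D2 [mD1 [M1 [g1 [A1_ g1M g1c]]]] [mD2 [M2 [g2 [A2_ g2M g2c]]]].
  split; first exact: measurableI.
  exists (M1 * M2), (fun n w => g1 n w * g2 n w); split.
  + by move=> n; exact/AM.
  + by move=> n w; rewrite normrM ler_pM.
  + by move=> w; rewrite indicI; apply: cvgM.
- by move=> E [].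
- by rewrite -[RHS]A1'; apply: eq_Rintegral => w _; rewrite mulr1.
- move=> E [mE [M [g_ [Ag_ gM gc]]]].
  have mpsi : measurable_fun setT psi by exact/measurable_EFinP/(measurable_int P).
  apply: (@Rintegral0_dominated _ _ _ _ (fun n w => psi w * g_ n w) _
            (fun w => `|psi w| * M)).
  + by move=> n; apply: measurable_funM => //; case: (Ab _ (Ag_ n)).
  + by apply: measurable_funM => //; exact: measurable_indic.
  + by move=> w; apply: cvgMr; exact: gc.
  + apply: integrable_mul_bounded; first exact: (integrable_abse ipsi).
    exact: bounded_rv_cst.
  + by move=> n w; rewrite normrM ler_wpM2l.
  + by move=> n; exact: psiA.
Qed.

(* The algebra spanned by the characters [cos (L + th)], [L] in [Lam]. *)
Inductive trig_poly Lam : (T -> R) -> Prop :=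
| trig_poly0 : trig_poly Lam (fun=> 0)
| trig_polyS c L th g : Lam L -> trig_poly Lam g ->
    trig_poly Lam (fun w => c * cos (L w + th) + g w).

Definition linear_family Lam := [/\ Lam (fun=> 0),
  forall c L, Lam L -> Lam (fun w => c * L w)
  & forall L L', Lam L -> Lam L' -> Lam (fun w => L w + L' w)].

Lemma trig_poly_ext Lam f g : trig_poly Lam f -> f =1 g -> trig_poly Lam g.
Proof. by move=> tf /funext <-. Qed.

Lemma trig_polyD Lam f g : trig_poly Lam f -> trig_poly Lam g ->
  trig_poly Lam (fun w => f w + g w).
Proof.
move=> + tg; elim=> [|c L th f' LL _ IH].
  by apply: trig_poly_ext tg _ => w; rewrite add0r.
by apply: trig_poly_ext (trig_polyS c th LL IH) _ => w; rewrite addrA.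
Qed.

Lemma trig_polyZ Lam r g : trig_poly Lam g -> trig_poly Lam (fun w => r * g w).
Proof.
elim=> [|c L th f' LL _ IH].
  by apply: trig_poly_ext (trig_poly0 Lam) _ => w; rewrite mulr0.
by apply: trig_poly_ext (trig_polyS (r * c) th LL IH) _ => w; rewrite mulrDr mulrA.
Qed.

Lemma cosM (x y : R) : cos x * cos y = 2^-1 * cos (x + y) + 2^-1 * cos (x - y).
Proof. by rewrite cosD cosB; field. Qed.

(** The product-to-sum formula turns two characters into characters of [L + L'] and [L - L'], which
    a linear family contains. *)
Lemma trig_polyM Lam f g : linear_family Lam -> trig_poly Lam f -> trig_poly Lam g ->
  trig_poly Lam (fun w => f w * g w).
Proof.
move=> [Lam0 LamZ LamD] tf tg; elim: tf => [|c L th f' LL _ IH].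
  by apply: trig_poly_ext (trig_poly0 Lam) _ => w; rewrite mul0r.
suff H : trig_poly Lam (fun w => c * (cos (L w + th) * g w)).
  by apply: trig_poly_ext (trig_polyD H IH) _ => w; rewrite mulrDl mulrA.
apply: trig_polyZ; elim: {f' IH} tg => [|c' L' th' g' LL' _ IH].
  by apply: trig_poly_ext (trig_poly0 Lam) _ => w; rewrite mulr0.
have H1 := LamD _ _ LL LL'.
have H2 := LamD _ _ LL (LamZ (-1) _ LL').
apply: trig_poly_ext
  (trig_polyS (c' * 2^-1) (th + th') H1 (trig_polyS (c' * 2^-1) (th - th') H2 IH)) _ => w.
have -> : L w + L' w + (th + th') = (L w + th) + (L' w + th') by ring.
have -> : L w + -1 * L' w + (th - th') = (L w + th) - (L' w + th') by ring.
by rewrite addrA -!mulrA -mulrDr -cosM; ring.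
Qed.

Lemma trig_poly1 Lam : linear_family Lam -> trig_poly Lam (fun=> 1).
Proof.
move=> [Lam0 _ _]; apply: trig_poly_ext (trig_polyS 1 0 Lam0 (trig_poly0 Lam)) _ => w.
by rewrite !addr0 cos0 mulr1.
Qed.

Lemma bounded_rv_cos (L : T -> R) th : measurable_fun setT L ->
  bounded_rv (fun w => cos (L w + th) : R).
Proof.
move=> mL; split.
  apply: measurableT_comp; first exact: continuous_measurable_fun (@continuous_cos R).
  by apply: measurable_funD.
by exists 1 => w; rewrite ler_norml cos_geN1 cos_le1.
Qed.

Lemma bounded_rv_trig_poly Lam g : (forall L, Lam L -> measurable_fun setT L) ->
  trig_poly Lam g -> bounded_rv g.
Proof.
move=> mLam; elim=> [|c L th g' LL _ IH]; first exact: bounded_rv_cst.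
apply: bounded_rvD => //; apply: bounded_rvM; first exact: bounded_rv_cst.
by apply: bounded_rv_cos; exact: mLam.
Qed.

Definition sigma_family Lam : set (set T) :=
  <<s [set D | exists L (B : set R), [/\ Lam L, measurable B & D = L @^-1` B]] >>.

(** The trigonometric polynomials of [Lam] serve as the algebra; it then remains to see that each
    [L] is measurable for the sigma-field generated by their sets [c < g]. *)
Lemma Rintegral0_sigma_family Lam psi : linear_family Lam ->
  (forall L, Lam L -> measurable_fun setT L) ->
  P.-integrable setT (EFin \o psi) ->
  (forall L th, Lam L -> \int[P]_w (psi w * cos (L w + th)) = 0) ->
  forall D, sigma_family Lam D -> \int[P]_w (psi w * \1_D w) = 0.
Proof.
move=> lLam mLam ipsi psi0 D sD.
have [Lam0 LamZ LamD] := lLam.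
apply: (@Rintegral0_algebra (trig_poly Lam)) => //.
- exact: trig_poly1.
- by move=> c g; exact: trig_polyZ.
- exact: trig_polyD.
- by move=> f g; exact: trig_polyM.
- by move=> g; exact: bounded_rv_trig_poly.
- move=> g; elim=> [|c L th g' LL tg' IH].
    by under eq_Rintegral do rewrite mulr0; rewrite Rintegral_cst// mul0r.
  under eq_Rintegral do rewrite mulrDr mulrCA.
  have ic : P.-integrable setT (EFin \o (fun w => psi w * cos (L w + th))).
    by apply: integrable_mul_bounded => //; apply: bounded_rv_cos; exact: mLam.
  rewrite RintegralD//.
  + by rewrite RintegralZl// psi0// IH mulr0 addr0.
  + by apply: (@integrableZl _ _ _ _ _ measurableT c (EFin \o _)) ic.
  + by apply: integrable_mul_bounded => //; exact: bounded_rv_trig_poly tg'.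
move: D sD; apply: smallest_sub; first exact: smallest_sigma_algebra.
move=> _ [L [B [LL mB ->]]].
set Pi := (X in <<s X >>).
have : measurable_fun setT (L : g_sigma_algebraType Pi -> R).
  move=> mD; apply: (measurability _ (RGenOInfty.measurableE R)) => //.
  move=> /= _ [_ [c ->] <-]; rewrite setTI.
  (* [c < L w] holds exactly when [sin ((L w - c) / k)] is positive for all large [k]: once [k]
     exceeds [|L w - c|], the argument lies in [[-1, 1]], where the sine has the sign of its
     argument. *)
  have -> : L @^-1` `]c, +oo[%classic =
      \bigcup_m \bigcap_n [set w | 0 < sin ((L w - c) / (n + m).+1%:R)].
    apply/seteqP; split => [w /=|w [m _ H]].
      rewrite in_itv /= andbT => cL; exists (Num.trunc (L w - c)) => // n _ /=.
      have k0 : 0 < (n + Num.trunc (L w - c)).+1%:R :> R by rewrite ltr0n.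
      apply: sin_gt0_pi; rewrite divr_gt0 ?subr_gt0//=.
      apply: (@lt_le_trans _ _ 1); last by have := @pihalf_ge1 R; lra.
      rewrite ltr_pdivrMr// mul1r.
      apply: (lt_le_trans (truncnS_gt _)).
      by rewrite ler_nat ltnS leq_addl.
    rewrite /= in_itv /= andbT ltNge; apply/negP => Lc.
    have /= := H (Num.trunc (c - L w)) I; set k : R := _.+1%:R => Hk.
    have k0 : 0 < k by rewrite ltr0n.
    have : 0 <= sin ((c - L w) / k).
      apply: sin_ge0_pi; apply/andP; split.
        by rewrite divr_ge0 ?subr_ge0// ltW.
      apply: (@le_trans _ _ 1); last by have := @pihalf_ge1 R; lra.
      rewrite ler_pdivrMr// mul1r ltW//.
      apply: (lt_le_trans (truncnS_gt _)).
      by rewrite ler_nat ltnS leq_addr.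
    by rewrite -opprB mulNr sinN oppr_ge0 leNgt Hk.
  apply: bigcup_measurable => m _; apply: bigcapT_measurable => n.
  apply: sub_sigma_algebra.
  pose k : R := (n + m).+1%:R^-1.
  (* As [sin y = cos (y - pi / 2)], the positivity set of the sine is a generator with threshold
     0. *)
  exists (fun w => 1 * cos (k * L w + (- (c * k) - pi / 2)) + 0), 0; split.
    by apply: trig_polyS; [exact: LamZ|exact: trig_poly0].
  apply/seteqP; split => w /=; rewrite addr0 mul1r addrA cosBpihalf mulrBl;
    by rewrite [k * _]mulrC.
by move=> /(_ measurableT B mB); rewrite setTI.
Qed.

End TrigonometricUniqueness.

(** * Characteristic functions of Gaussian variables *)

Section NormalLaw.
Variable R : realType.
Notation mu := (@lebesgue_measure R).

(** The fundamental theorem of calculus on growing intervals, with the limit taken by dominated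
    convergence under [|h|]. *)
Lemma integral_derive0 (H h : R -> R) : (forall x, is_derive x (1 : R) H (h x)) ->
  continuous h -> mu.-integrable setT (EFin \o h) ->
  H n%:R @[n --> \oo] --> 0 -> H (- n%:R) @[n --> \oo] --> 0 ->
  (\int[mu]_x (h x)%:E = 0)%E.
Proof.
move=> dH ch ih H1 H2.
have mh : measurable_fun setT (EFin \o h) by exact: measurable_int ih.
(* The shift to [n.+1] keeps the interval nondegenerate, as the fundamental theorem requires. *)
pose I (n : nat) : set R := `[- n.+1%:R, n.+1%:R]%classic.
pose h_ n := (EFin \o h) \_ (I n).
have int_h n : (\int[mu]_x h_ n x = (H n.+1%:R - H (- n.+1%:R))%:E)%E.
  rewrite /h_ -integral_mkcond (@continuous_FTC2 _ h H) //.
  - by have : 0 < n.+1%:R :> R := ltr0Sn _ _; lra.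
  - by apply: continuous_subspaceT.
  - split.
    + by move=> x _; exact: (@ex_derive _ _ _ _ _ _ _ (dH x)).
    + apply: cvg_at_right_filter; apply: differentiable_continuous.
      by apply/derivable1_diffP; exact: (@ex_derive _ _ _ _ _ _ _ (dH _)).
    + apply: cvg_at_left_filter; apply: differentiable_continuous.
      by apply/derivable1_diffP; exact: (@ex_derive _ _ _ _ _ _ _ (dH _)).
  - by move=> x _; rewrite derive1E; exact: (@derive_val _ _ _ _ _ _ _ (dH x)).
have mh_ n : measurable_fun setT (h_ n).
  have mI : measurable (I n) by exact: measurable_itv.
  by apply/(measurable_restrictT _ mI); exact: measurable_funTS.
have ch_ : {ae mu, forall x, setT x -> h_ n x @[n --> \oo] --> (EFin \o h) x}.
  apply/aeW => x _; apply: cvg_near_cst; near=> n.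
  have xI : x \in I n.
    apply/mem_set; rewrite /I /= in_itv /= -ler_norml.
    apply: (@le_trans _ _ n%:R); last by rewrite ler_nat.
    by near: n; exact: nbhs_infty_ger.
  by rewrite /h_ patchE xI.
have hh_ : {ae mu, forall x n, setT x -> (`|h_ n x| <= `|(EFin \o h) x|)%E}.
  by apply/aeW => x n _; rewrite /h_ patchE; case: ifPn => // _; rewrite abse0.
have [_ _] := @dominated_convergence _ _ _ mu setT measurableT h_ (EFin \o h)
  (fun x => `|(EFin \o h) x|)%E mh_ mh ch_ (integrable_abse ih) hh_.
under eq_fun do rewrite int_h.
move=> c; have /cvg_lim c0 : (H n.+1%:R - H (- n.+1%:R))%:E @[n --> \oo] --> 0%E.
  apply: cvg_EFin; first exact: nearW.
  rewrite -[X in _ --> X]subr0; apply: cvgB; first by rewrite (cvg_shiftS (fun n => H n%:R)).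
  by rewrite (cvg_shiftS (fun n => H (- n%:R))).
by move/cvg_lim : c => <- //; exact: c0.
Unshelve. all: end_near. Qed.

Variables (m s : R).
Hypothesis s0 : s != 0.
Notation p := (normal_pdf m s).
Notation N := (normal_prob m s).

Let pE x : p x = normal_peak s * expR (- (x - m) ^+ 2 / (s ^+ 2 *+ 2)).
Proof. by rewrite normal_pdfE. Qed.

Lemma is_derive_normal_pdf x : is_derive x (1 : R) p (- (x - m) / s ^+ 2 * p x).
Proof.
have -> : p = fun x => normal_peak s * expR (- (x - m) ^+ 2 / (s ^+ 2 *+ 2)).
  by apply/funext => y; rewrite pE.
apply: is_derive_eq.
rewrite /GRing.scale /=.
by field.
Qed.

(** Dominates, up to constants, the integrands in Stein's identity when [F] has linear growth and a
    bounded derivative. *)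
Let W x := (1 + (x - m) ^+ 2) * p x.

(** Doubling the variance absorbs the quadratic factor: with [u = (x - m)^2 / (4 s^2)] the claim
    reduces to [1 + 4 s^2 u <= (1 + 4 s^2) exp u], which follows from [1 + u <= exp u]. *)
Lemma second_moment_density_le : exists2 K : R, 0 <= K &
  forall x, W x <= K * normal_pdf m (Num.sqrt 2 * s) x.
Proof.
have s2 : 0 < s ^+ 2 by rewrite exprn_even_gt0.
have s'0 : Num.sqrt 2 * s != 0 :> R by rewrite mulf_neq0// gt_eqF// sqrtr_gt0.
exists ((1 + 4 * s ^+ 2) * (normal_peak s / normal_peak (Num.sqrt 2 * s))).
  apply: mulr_ge0; first by rewrite addr_ge0// mulr_ge0// ltW.
  by rewrite divr_ge0 ?normal_peak_ge0.
move=> x; rewrite /W pE (normal_pdfE _ s'0).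
set u := (x - m) ^+ 2 / (4 * s ^+ 2).
have u0 : 0 <= u by rewrite divr_ge0 ?sqr_ge0// mulr_ge0// ltW.
have -> : - (x - m) ^+ 2 / (s ^+ 2 *+ 2) = - u - u by rewrite /u; field.
rewrite /normal_fun exprMn sqr_sqrtr//.
have -> : - (x - m) ^+ 2 / (2 * s ^+ 2 *+ 2) = - u by rewrite /u; field.
have -> : (x - m) ^+ 2 = 4 * s ^+ 2 * u by rewrite /u; field.
have pk : 0 < normal_peak (Num.sqrt 2 * s) by exact: normal_peak_gt0.
rewrite expRB; move: u u0 => u u0.
have -> : (1 + 4 * s ^+ 2) * (normal_peak s / normal_peak (Num.sqrt 2 * s)) *
    (normal_peak (Num.sqrt 2 * s) * expR (- u)) =
    (1 + 4 * s ^+ 2) * (normal_peak s * expR (- u)).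
  by rewrite -!mulrA; congr (_ * (_ * _)); rewrite mulrA mulVf ?mul1r ?gt_eqF.
have -> : (1 + 4 * s ^+ 2 * u) * (normal_peak s * (expR (- u) / expR u)) =
   (1 + 4 * s ^+ 2 * u) / expR u * (normal_peak s * expR (- u)).
  by rewrite mulrA -mulrA [RHS]mulrC mulrCA; ring.
apply: ler_wpM2r; first by rewrite mulr_ge0 ?normal_peak_ge0 ?expR_ge0.
rewrite ler_pdivrMr ?expR_gt0//.
have e1 := expR_ge1Dx u.
have := mulr_ge0 (ltW s2) u0; have := ler_wpM2l (ltW s2) e1; lra.
Qed.

Lemma integrable_second_moment_density : mu.-integrable setT (EFin \o W).
Proof.
have [K K0 WK] := second_moment_density_le.
have i1 : mu.-integrable setT (EFin \o (fun x => K * normal_pdf m (Num.sqrt 2 * s) x)).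
  exact: (@integrableZl _ _ _ _ _ measurableT K _ (integrable_normal_pdf m (Num.sqrt 2 * s))).
apply: le_integrable i1 => //.
  apply/measurable_EFinP; apply: measurable_funM; last exact: measurable_normal_pdf.
  by apply: measurable_funD => //; apply: measurable_funX; exact: measurable_funB.
move=> x _; rewrite /= lee_fin !ger0_norm ?WK//.
  by rewrite mulr_ge0// normal_pdf_ge0.
by rewrite mulr_ge0 ?normal_pdf_ge0// addr_ge0 ?sqr_ge0.
Qed.

Lemma second_moment_density_bounded : exists M, forall x, W x <= M.
Proof.
have [K K0 WK] := second_moment_density_le.
exists (K * normal_peak (Num.sqrt 2 * s)) => x; apply: (le_trans (WK x)).
by rewrite ler_wpM2l// normal_pdf_ub// mulf_neq0// gt_eqF// sqrtr_gt0.
Qed.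


(** [F * p] vanishes at infinity and has derivative [F' p - s^-2 F (x - m) p], because
    [p' = - s^-2 (x - m) p]; integrating over the line gives the identity. *)
Lemma stein (F F' : R -> R) (A : R) : (forall x, is_derive x (1 : R) F (F' x)) ->
  continuous F' -> (forall x, `|F x| <= A * (1 + `|x - m|)) -> (forall x, `|F' x| <= A) ->
  [/\ mu.-integrable setT (EFin \o (fun x => F' x * p x)),
      mu.-integrable setT (EFin \o (fun x => F x * (x - m) * p x))
    & \int[mu]_x (F x * (x - m) * p x) = s ^+ 2 * \int[mu]_x (F' x * p x)].
Proof.
move=> dF cF' FA F'A.
have A0 : 0 <= A by apply: le_trans (F'A 0).
have iW := integrable_second_moment_density.
have [M WM] := second_moment_density_bounded.
have p0 x : 0 <= p x := normal_pdf_ge0 m s x.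
have W0 x : 0 <= W x by rewrite mulr_ge0// addr_ge0 ?sqr_ge0.
have cF : continuous F.
  move=> x; apply: differentiable_continuous; apply/derivable1_diffP.
  exact: (@ex_derive _ _ _ _ _ _ _ (dF x)).
have cp : continuous p by exact: continuous_normal_pdf.
have cxm : continuous (fun x : R => x - m).
  by move=> x; apply: cvgB; [exact: cvg_id|exact: cvg_cst].
have sq x : `|x - m| * (1 + `|x - m|) <= 2 * (1 + (x - m) ^+ 2).
  rewrite -[(x - m) ^+ 2]real_normK ?num_real//; set y := `|x - m|.
  by have := sqr_ge0 (y - 1); have := sqr_ge0 y; rewrite !expr2; lra.
have mE (g : R -> R) : continuous g -> measurable_fun setT (EFin \o g).
  by move=> cg; apply/measurable_EFinP; exact: continuous_measurable_fun.
have i1 : mu.-integrable setT (EFin \o (fun x => F' x * p x)).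
  have iAW : mu.-integrable setT (EFin \o (fun x => A * W x)).
    exact: (@integrableZl _ _ _ _ _ measurableT A _ iW).
  apply: le_integrable iAW => //.
    apply: mE => x.
    by apply: cvgM; [exact: cF'|exact: cp].
  move=> x _; rewrite /= lee_fin !normrM ler_pM// ?normr_ge0//.
    by rewrite [X in _ <= X]ger0_norm.
  rewrite -normrM (ger0_norm (W0 x)) ger0_norm// /W mulrDl mul1r lerDl.
  by rewrite mulr_ge0 ?sqr_ge0.
have i2 : mu.-integrable setT (EFin \o (fun x => F x * (x - m) * p x)).
  have iAW : mu.-integrable setT (EFin \o (fun x => (2 * A) * W x)).
    exact: (@integrableZl _ _ _ _ _ measurableT (2 * A) _ iW).
  apply: le_integrable iAW => //.
    apply: mE => x.
    by apply: cvgM; [apply: cvgM; [exact: cF|exact: cxm]|exact: cp].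
  move=> x _; rewrite /= lee_fin !normrM (ger0_norm (p0 x)) -normrM (ger0_norm A0).
  rewrite normr_nat (@ger0_norm _ (1 + _)) ?addr_ge0 ?sqr_ge0// mulrA.
  apply: ler_wpM2r => //; rewrite normrM.
  apply: (@le_trans _ _ (A * (1 + `|x - m|) * `|x - m|)).
    by apply: ler_wpM2r.
  by have := ler_wpM2l A0 (sq x); lra.
split=> //.
pose h x := F' x * p x - (s ^+ 2)^-1 * (F x * (x - m) * p x).
have i3 : mu.-integrable setT (EFin \o (fun x => (s ^+ 2)^-1 * (F x * (x - m) * p x))).
  exact: (@integrableZl _ _ _ _ _ measurableT (s ^+ 2)^-1 _ i2).
have dH x : is_derive x (1 : R) (F * p) (h x).
  have dp := is_derive_normal_pdf x; have dFx := dF x.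
  apply: is_derive_eq; rewrite /GRing.scale /= /h; field.
  by [].
have ch : continuous h.
  move=> x; apply: cvgB; first by apply: cvgM; [exact: cF'|exact: cp].
  apply: cvgM; first exact: cvg_cst.
  by apply: cvgM; [apply: cvgM; [exact: cF|exact: cxm]|exact: cp].
(* One factor [1 + |x - m|] bounds [F], a second one pays for [1 + |x|], and [p] times their product
   is bounded because [W] is. *)
have decay (x : R) : `|(F * p) x| <= A * (1 + `|m|) * (3 * M) / (1 + `|x|).
  rewrite ler_pdivlMr ?ltr_pwDl//.
  have h1 : 1 + `|x| <= (1 + `|m|) * (1 + `|x - m|).
    have : `|x| <= `|x - m| + `|m| by rewrite -{1}(subrK m x) ler_normD.
    by have := mulr_ge0 (normr_ge0 m) (normr_ge0 (x - m)); lra.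
  have h2 : (1 + `|x - m|) * (1 + `|x - m|) * p x <= 3 * M.
    apply: (@le_trans _ _ (3 * W x)); last by rewrite ler_wpM2l.
    rewrite /W mulrA; apply: ler_wpM2r => //.
    rewrite -[(x - m) ^+ 2]real_normK ?num_real//; set y := `|x - m|.
    by have := sqr_ge0 (y - 1); have := sqr_ge0 y; rewrite !expr2; lra.
  rewrite normrM (ger0_norm (p0 x)).
  apply: (@le_trans _ _ (A * (1 + `|x - m|) * p x * ((1 + `|m|) * (1 + `|x - m|)))).
    apply: ler_pM => //; [by rewrite mulr_ge0|by rewrite ler_wpM2r].
  have -> : A * (1 + `|x - m|) * p x * ((1 + `|m|) * (1 + `|x - m|)) =
    A * (1 + `|m|) * ((1 + `|x - m|) * (1 + `|x - m|) * p x) by ring.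
  by rewrite ler_wpM2l// mulr_ge0.
have cdecay (u : nat -> R) : (forall n, `|u n| = n%:R) -> (F * p) (u n) @[n --> \oo] --> 0.
  move=> un; set B := A * (1 + `|m|) * (3 * M).
  have cB : B / (1 + n%:R) @[n --> \oo] --> (0 : R).
    rewrite -[X in _ --> X](mulr0 B); apply: cvgMr.
    rewrite (_ : (fun n : nat => (1 + n%:R)^-1 : R) = harmonic).
      exact: cvg_harmonic.
    by apply/funext => n; rewrite /= -natr1 addrC.
  have cNB : - (B / (1 + n%:R)) @[n --> \oo] --> (0 : R).
    by rewrite -[X in _ --> X]oppr0; apply: cvgN.
  apply: (squeeze_cvgr _ cNB cB); apply: nearW => n.
  by rewrite -ler_norml -(un n); exact: decay.
have ih : mu.-integrable setT (EFin \o h).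
  have -> : EFin \o h = ((EFin \o (fun x => F' x * p x)%R)
      \- (EFin \o (fun x => (s ^+ 2)^-1 * (F x * (x - m) * p x))%R))%E.
    by apply/funext => x /=; rewrite -EFinB.
  exact: integrableB.
have h0 : \int[mu]_x h x = 0.
  rewrite /Rintegral (@integral_derive0 (F * p) h)//.
    by apply: cdecay => n; rewrite normr_nat.
  by apply: cdecay => n; rewrite normrN normr_nat.
move: h0; rewrite /h RintegralB// RintegralZl// => /eqP; rewrite subr_eq0 => /eqP ->.
by rewrite mulrA divff ?mul1r// expf_neq0.
Qed.


(** Both functions integrate to [N E] over every measurable [E], which determines a density almost
    everywhere. *)
Lemma normal_prob_density :
  ae_eq mu setT (Radon_Nikodym (charge_of_finite_measure N) mu) (EFin \o p).
Proof.
have dom : N `<< mu by exact: normal_prob_dominates.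
apply: integral_ae_eq => //.
- exact: Radon_Nikodym_integrable.
- by apply/measurable_EFinP; exact: measurable_normal_pdf.
- by move=> E _ mE; rewrite -Radon_Nikodym_integral.
Qed.

Lemma ge0_integral_normal_prob (f : R -> R) : measurable_fun setT f ->
  (forall x, 0 <= f x) -> (\int[N]_x (f x)%:E = \int[mu]_x (f x * p x)%:E)%E.
Proof.
move=> mf f0; have dom : N `<< mu by exact: normal_prob_dominates.
have mef : measurable_fun setT (EFin \o f) by exact/measurable_EFinP.
have mp : measurable_fun setT (EFin \o p).
  by apply/measurable_EFinP; exact: measurable_normal_pdf.
rewrite -(Radon_Nikodym_SigmaFinite.change_of_variables dom _ _ mef)//.
under [RHS]eq_integral do rewrite EFinM.
apply: ae_eq_integral => //.
- apply: emeasurable_funM => //.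
  exact: measurable_int (Radon_Nikodym_SigmaFinite.f_integrable dom).
- exact: emeasurable_funM.
- apply: ae_eqe_mul2l; apply: ae_eq_trans normal_prob_density.
  exact: ae_eq_Radon_Nikodym_SigmaFinite.
Qed.

Lemma Rintegral_normal_prob (f : R -> R) : measurable_fun setT f ->
  mu.-integrable setT (EFin \o (fun x => f x * p x)) ->
  N.-integrable setT (EFin \o f) /\ \int[N]_x f x = \int[mu]_x (f x * p x).
Proof.
move=> mf /integrableP[_ ifp].
have iN : N.-integrable setT (EFin \o f).
  apply/integrableP; split; first exact/measurable_EFinP.
  rewrite [ltLHS](ge0_integral_normal_prob (f := fun x => `|f x|)) //.
    move: ifp; congr (_ < _)%E; apply: eq_integral => x _.
    by rewrite /= normrM (ger0_norm (normal_pdf_ge0 _ _ _)).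
  exact: measurableT_comp.
split=> //; congr fine.
have dom : N `<< mu by exact: normal_prob_dominates.
rewrite -[LHS](Radon_Nikodym_change_of_variables dom measurableT iN).
under [RHS]eq_integral do rewrite EFinM.
apply: ae_eq_integral => //.
- apply: emeasurable_funM; first exact: measurable_int iN.
  by apply: (measurable_int mu); exact: Radon_Nikodym_integrable.
- apply: emeasurable_funM; first exact: measurable_int iN.
  by apply/measurable_EFinP; exact: measurable_normal_pdf.
- exact: ae_eqe_mul2l normal_prob_density.
Qed.

Lemma normal_prob_stein (F F' : R -> R) (A : R) :
  (forall x, is_derive x (1 : R) F (F' x)) -> continuous F' ->
  (forall x, `|F x| <= A * (1 + `|x - m|)) -> (forall x, `|F' x| <= A) ->
  N.-integrable setT (EFin \o (fun x => F x * (x - m))) /\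
  \int[N]_x (F x * (x - m)) = s ^+ 2 * \int[N]_x F' x.
Proof.
move=> dF cF' FA F'A; have [i1 i2 e] := stein dF cF' FA F'A.
have cF : continuous F.
  move=> x; apply: differentiable_continuous; apply/derivable1_diffP.
  exact: (@ex_derive _ _ _ _ _ _ _ (dF x)).
have [|_ ->] := Rintegral_normal_prob _ i1; first exact: continuous_measurable_fun.
have [|? ->//] := Rintegral_normal_prob _ i2.
apply: measurable_funM; first exact: continuous_measurable_fun.
exact: measurable_funB.
Qed.

Lemma normal_prob_moments :
  [/\ N.-integrable setT (fun x => (x - m)%:E), \int[N]_x (x - m) = 0,
      N.-integrable setT (fun x => ((x - m) ^+ 2)%:E) & \int[N]_x ((x - m) ^+ 2) = s ^+ 2].
Proof.
(* Stein's identity for [F = 1] gives the mean. *)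
have d1 (x : R) : is_derive x (1 : R) (fun=> 1 : R) 0 by exact: is_derive_cst.
have [||x|i1 e1] := normal_prob_stein (A := 1) d1.
- by move=> x; exact: cvg_cst.
- by move=> x; rewrite mul1r normr1 lerDl.
- by rewrite normr0.
(* Stein's identity for [F = x - m] gives the variance. *)
have d2 (x : R) : is_derive x (1 : R) (fun x => x - m) 1.
  by apply: is_derive_eq; rewrite subr0.
have [||x|i2 e2] := normal_prob_stein (A := 1) d2.
- by move=> x; exact: cvg_cst.
- by move=> x; rewrite mul1r lerDr.
- by rewrite normr1.
split.
- by apply: eq_integrable i1 => // x _; rewrite /= mul1r.
- by under eq_Rintegral do rewrite -[_ - _]mul1r; rewrite e1 Rintegral_cst// mul0r mulr0.
- by apply: eq_integrable i2 => // x _; rewrite /= expr2.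
- under eq_Rintegral do rewrite expr2.
  rewrite e2 Rintegral_cst// [X in fine X](_ : _ = 1%E) /= ?mulr1//.
  exact: (@probability_setT _ _ _ N).
Qed.

(* The characteristic function satisfies [phi' t = - s^2 t phi t]. *)
Lemma normal_prob_cos (th : R) :
  \int[N]_x cos (x - m + th) = cos th * expR (- s ^+ 2 / 2).
Proof.
have [i1 _ _ _] := normal_prob_moments.
(* The parameter [t] scales the deviation: [phi 0] is [cos th] and [phi 1] is the integral
   sought. *)
pose f (t x : R) := cos (t * (x - m) + th).
pose phi t := \int[N]_x f t x.
have bf t : bounded_rv (fun x : R => cos (t * (x - m) + th) : R).
  split; last by exists 1 => x; rewrite ler_norml cos_geN1 cos_le1.
  apply: measurableT_comp; first exact: continuous_measurable_fun (@continuous_cos R).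
  by apply: measurable_funD => //; apply: measurable_funM => //; exact: measurable_funB.
have intf t : N.-integrable setT (EFin \o f t) 
  by exact: (@integrable_bounded _ (measurableTypeR R) R (normal_prob m s) (f t) (bf t)).
have df t x : is_derive t (1 : R) (f ^~ x) (- (x - m) * sin (t * (x - m) + th)).
  apply: is_derive_eq; rewrite /GRing.scale /=; ring.
have dphi t : is_derive t (1 : R) phi (- s ^+ 2 * t * phi t).
  (* Differentiation under the integral takes place on this neighbourhood of [t], with dominating
     function [|y - m|]. *)
  have It : t \in `]t - 1, t + 1[ by rewrite in_itv /=; apply/andP; split; lra.
  have G1 x y : `](t - 1), (t + 1)[%classic x -> setT y -> `|partial1of2 f x y| <= `|y - m|.
    move=> _ _; rewrite partial1of2E (@derive_val _ _ _ _ _ _ _ (df x y)).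
    by rewrite normrM normrN ler_piMr// ler_norml sin_geN1 sin_le1.
  have iG : N.-integrable setT (EFin \o (fun y => `|y - m|)) by exact: (integrable_abse i1).
  have d1 x y : `](t - 1), (t + 1)[%classic x -> setT y -> derivable (f ^~ y) x 1.
    by move=> _ _; exact: (@ex_derive _ _ _ _ _ _ _ (df x y)).
  have D1 := derivable_under_integral measurableT It (fun x _ => intf x) d1
    (fun y => normr_ge0 (y - m)) iG G1.
  have D2 := differentiation_under_integral measurableT It (fun x _ => intf x) d1
    (fun y => normr_ge0 (y - m)) iG G1.
  apply: DeriveDef => //; rewrite -derive1E D2.
  (* Stein's identity for [sin (t * (x - m) + th)] trades the factor [x - m] for [s ^+ 2 * t] times
     the cosine. *)
  have dF (x : R) : is_derive x (1 : R) (fun x => sin (t * (x - m) + th))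
      (t * cos (t * (x - m) + th)).
    by apply: is_derive_eq; rewrite /GRing.scale /=; ring.
  have cF' : continuous (fun x : R => t * cos (t * (x - m) + th)).
    move=> x; apply: cvgMr.
    apply: (@continuous_comp _ _ _ (fun x : R => t * (x - m) + th) (@cos R)).
      apply: cvgD; last exact: cvg_cst.
      by apply: cvgMr; apply: cvgB; [exact: cvg_id|exact: cvg_cst].
    exact: continuous_cos.
  have [|x|i2 e2] := normal_prob_stein (A := 1 + `|t|) dF cF'.
  - move=> x; apply: (@le_trans _ _ 1); first by rewrite ler_norml sin_geN1 sin_le1.
    by have := mulr_ge0 (normr_ge0 t) (normr_ge0 (x - m));
      have := normr_ge0 t; have := normr_ge0 (x - m); lra.
  - rewrite normrM (@le_trans _ _ `|t|)//; last by rewrite lerDr.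
    by rewrite ler_piMr// ler_norml cos_geN1 cos_le1.
  transitivity (\int[N]_x (- 1 * (sin (t * (x - m) + th) * (x - m)))).
    apply: eq_Rintegral => x _; rewrite partial1of2E (@derive_val _ _ _ _ _ _ _ (df t x)).
    by ring.
  rewrite RintegralZl// e2 RintegralZl//; last exact: intf.
  by rewrite /phi /f; ring.
(* The differential equation makes [phi t * exp (s^2 t^2 / 2)] constant; its values at 0 and 1 are
   then compared. *)
have dg t : is_derive t (1 : R) (fun t => phi t * expR (s ^+ 2 * t ^+ 2 / 2)) 0.
  have dphit := dphi t.
  by apply: is_derive_eq; rewrite /GRing.scale /=; field.
have := @is_derive_0_is_cst _ _ 1 0 dg.
rewrite expr0n /= mulr0 mul0r expR0 mulr1 expr1n mulr1.
have -> : phi 0 = cos th.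
  rewrite /phi /f; under eq_Rintegral do rewrite mul0r add0r.
  by rewrite Rintegral_cst// [X in fine X](_ : _ = 1%E) /= ?mulr1//;
    exact: (@probability_setT _ _ _ N).
have -> : phi 1 = \int[N]_x cos (x - m + th).
  by rewrite /phi /f; under eq_Rintegral do rewrite mul1r.
by move=> <-; rewrite -mulrA -expRD mulNr addrN expR0 mulr1.
Qed.

End NormalLaw.

(** * Gaussian random variables through their laws *)

Lemma integral_law d d' (T : measurableType d) (T' : measurableType d') (R : realType)
    (P : {measure set T -> \bar R}) (nu : {measure set T' -> \bar R})
    (X : T -> T') (f : T' -> R) :
  measurable_fun setT X -> (forall B, measurable B -> P (X @^-1` B) = nu B) ->
  nu.-integrable setT (EFin \o f) ->
  P.-integrable setT (EFin \o (fun w => f (X w))) /\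
  \int[P]_w f (X w) = \int[nu]_x f x.
Proof.
move=> mX law inu.
have mf : measurable_fun setT (EFin \o f) := measurable_int nu inu.
have iP : P.-integrable (X @^-1` setT) ((EFin \o f) \o X).
  apply/integrableP; split; first exact: measurableT_comp.
  rewrite [ltLHS](_ : _ = \int[P]_(x in X @^-1` setT) ((abse \o (EFin \o f)) \o X) x)%E//.
  rewrite -ge0_integral_pushforward//.
  rewrite (@eq_measure_integral _ _ _ _ nu).
    by have /integrableP[] := inu.
  by move=> B mB _; rewrite /= /pushforward law.
  exact: measurableT_comp.
  by move=> x _; exact: abse_ge0.
split=> //; rewrite /Rintegral; congr fine.
rewrite [LHS](_ : _ = \int[P]_(x in X @^-1` setT) ((EFin \o f) \o X) x)%E//.
rewrite -integral_pushforward//.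
by apply: eq_measure_integral => B mB _; rewrite /= /pushforward law.
Qed.

Section GaussianVariables.
Context d (T : measurableType d) (R : realType) (P : probability T R).
Implicit Types X Y : T -> R.

(** A single [nu] covers the normal law and, for [s = 0], the point mass at [m], so that degenerate
    Gaussians need no separate treatment afterwards. *)
Lemma gaussian_law_moments (m s : R) : exists nu : probability (measurableTypeR R) R,
  [/\ forall B, measurable B -> gaussian_law m s B = nu B,
      nu.-integrable setT (fun x : R => (x - m)%:E), \int[nu]_(x in setT) (x - m : R) = 0,
      nu.-integrable setT (fun x : R => ((x - m) ^+ 2)%:E)
    & \int[nu]_x ((x - m) ^+ 2) = s ^+ 2 /\
      forall th, \int[nu]_x cos (x - m + th) = cos th * expR (- s ^+ 2 / 2)].
Proof.
have mxm : measurable_fun setT (fun x : measurableTypeR R => x - m : R).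
  by exact: measurable_funB.
have [s0|s0] := eqVneq s 0; last first.
  have [i1 e1 i2 e2] := normal_prob_moments m s0.
  exists (normal_prob m s); split=> //.
    by move=> B mB; rewrite /gaussian_law (negbTE s0).
  by split=> // th; exact: normal_prob_cos.
pose D : probability (measurableTypeR R) R := @dirac _ (measurableTypeR R) m R.
have di (f : measurableTypeR R -> R) : measurable_fun setT f ->
    D.-integrable setT (EFin \o f) /\ \int[D]_x f x = f m.
  move=> mf; have mef : measurable_fun setT (EFin \o f) by exact/measurable_EFinP.
  split; last by rewrite /Rintegral integral_dirac// diracT mul1e.
  apply/integrableP; split=> //; rewrite integral_dirac//; last exact: measurableT_comp.
  by rewrite diracT mul1e ltry.
exists D; split.
- by move=> B mB; rewrite /gaussian_law s0 eqxx.
- exact: (di _ mxm).1.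
- by rewrite (di _ mxm).2 subrr.
- by apply: (di _ _).1; exact: measurable_funX.
- split; first by rewrite (di _ _).2 ?subrr ?s0//; exact: measurable_funX.
  move=> th; rewrite (di (fun x => cos (x - m + th)) _).2.
    by rewrite subrr add0r s0 expr0n /= oppr0 mul0r expR0 mulr1.
  apply: measurableT_comp; first exact: continuous_measurable_fun (@continuous_cos R).
  exact: measurable_funD.
Qed.

Lemma gaussian_rv_square_integrable X : gaussian_rv P X ->
  P.-integrable setT (EFin \o (fun w => X w ^+ 2)).
Proof.
move=> [mX [m [s law]]].
have [nu [lawnu i1 _ i2 _]] := gaussian_law_moments m s.
have law' B : measurable B -> P (X @^-1` B) = nu B.
  by move=> mB; rewrite law// lawnu.
have [i1' _] := @integral_law _ _ T (measurableTypeR R) R P nu X _ mX law' i1.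
have [i2' _] := @integral_law _ _ T (measurableTypeR R) R P nu X _ mX law' i2.
have -> : EFin \o (fun w => X w ^+ 2) =
    ((EFin \o (fun w => ((X w - m) ^+ 2)%R)) \+
     ((EFin \o (fun w => (2 * m * (X w - m))%R)) \+ (EFin \o cst (m ^+ 2)%R)))%E.
  by apply/funext => w /=; rewrite -!EFinD; congr (_%:E); ring.
apply: integrableD => //; apply: integrableD => //.
  exact: (@integrableZl _ _ _ _ _ measurableT (2 * m) _ i1').
exact: finite_measure_integrable_cst.
Qed.

Lemma gaussian_rv_cos X th : gaussian_rv P X -> \int[P]_w X w = 0 ->
  \int[P]_w cos (X w + th) = cos th * expR (- (\int[P]_w (X w ^+ 2)) / 2).
Proof.
move=> [mX [m [s law]]] EX.
have [nu [lawnu i1 e1 i2 [e2 e3]]] := gaussian_law_moments m s.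
have law' B : measurable B -> P (X @^-1` B) = nu B.
  by move=> mB; rewrite law// lawnu.
have [i1' e1'] := @integral_law _ _ T (measurableTypeR R) R P nu X _ mX law' i1.
(* [X - m] integrates to zero under the law, so [m] is the mean of [X]. *)
have m0 : m = 0.
  have iX : P.-integrable setT (EFin \o X).
    have -> : EFin \o X = ((EFin \o (fun w => (X w - m)%R)) \+ (EFin \o cst m))%E.
      by apply/funext => w /=; rewrite -EFinD subrK.
    by apply: integrableD => //; exact: finite_measure_integrable_cst.
  have := e1'; rewrite e1 RintegralB ?EX// ?Rintegral_cst//; last first.
    exact: finite_measure_integrable_cst.
  have -> : fine (P [set: T]) = 1 by rewrite [X in fine X]probability_setT.
  rewrite mulr1 sub0r.
  by move/eqP; rewrite oppr_eq0 => /eqP.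
have [_ e2'] := @integral_law _ _ T (measurableTypeR R) R P nu X _ mX law' i2.
have ic : nu.-integrable setT (EFin \o (fun x : R => cos (x - m + th))).
  apply: integrable_bounded; split; last first.
    by exists 1 => x; rewrite ler_norml cos_geN1 cos_le1.
  apply: measurableT_comp; first exact: continuous_measurable_fun (@continuous_cos R).
  by apply: measurable_funD => //; exact: measurable_funB.
have [_ e3'] := @integral_law _ _ T (measurableTypeR R) R P nu X _ mX law' ic.
have := e3 th; rewrite -e3' -e2 -e2'.
have -> : \int[P]_w cos (X w - m + th) = \int[P]_w cos (X w + th).
  by apply: eq_Rintegral => w _; rewrite m0 subr0.
move=> ->; congr (_ * expR (- _ / 2)).
by apply: eq_Rintegral => w _; rewrite m0 subr0.
Qed.

End GaussianVariables.

(** * Conditional probabilities *)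

Section ConditionalProbability.
Context d (T : measurableType d) (R : realType) (P : probability T R).
Variable gens : set (set T).
Hypothesis mgens : forall D, gens D -> measurable D.
Notation G := (<<s gens>>).

Lemma measurable_generated D : G D -> measurable D.
Proof. by apply: smallest_sub => //; exact: sigma_algebra_measurable. Qed.

Lemma integral_in_indic (f : T -> R) D :
  (\int[P]_(w in D) (f w)%:E = \int[P]_w (f w * \1_D w)%:E)%E.
Proof.
rewrite integral_mkcond; apply: eq_integral => w _.
rewrite patchE indicE; by case: ifPn => _; rewrite ?mulr1 ?mulr0.
Qed.

Lemma integral_indicM A D : measurable A -> measurable D ->
  (\int[P]_w (\1_A w * \1_D w)%:E = P (A `&` D))%E.
Proof.
move=> mA mD; rewrite -integral_in_indic integral_indic//.
Qed.

Lemma is_cond_prob_measurable A f : is_cond_prob P G A f -> measurable_fun setT f.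
Proof.
by move=> [mf _ _] _ B mB; rewrite setTI; apply: measurable_generated; exact: mf.
Qed.

Lemma integrable_indic_sub A (f : T -> R) : measurable A ->
  P.-integrable setT (EFin \o f) ->
  P.-integrable setT (EFin \o (fun w => \1_A w - f w)).
Proof.
move=> mA fi.
have -> : EFin \o (fun w => \1_A w - f w) = ((EFin \o \1_A) \- (EFin \o f))%E.
  by apply/funext => w /=; rewrite EFinB.
by apply: integrableB => //; apply: integrable_bounded; exact: bounded_rv_indic.
Qed.

(** Puts the defining property in the form of vanishing integrals, the form in which
    [Rintegral0_mul] extends it from events to functions. *)
Lemma is_cond_probP A f : measurable A ->
  (forall B : set R, measurable B -> G (f @^-1` B)) ->
  P.-integrable setT (EFin \o f) ->
  is_cond_prob P G A f <->
  forall D, G D -> \int[P]_w ((\1_A w - f w) * \1_D w) = 0.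
Proof.
move=> mA mf fi.
have H D : measurable D -> (\int[P]_(w in D) (f w)%:E = P (A `&` D))%E <->
    \int[P]_w ((\1_A w - f w) * \1_D w) = 0.
  move=> mD.
  have iD : bounded_rv (\1_D : T -> R) by exact: bounded_rv_indic.
  have i1 : P.-integrable setT (EFin \o (fun w => \1_A w * \1_D w)).
    by apply: integrable_bounded; apply: bounded_rvM => //; exact: bounded_rv_indic.
  have i2 : P.-integrable setT (EFin \o (fun w => f w * \1_D w)).
    exact: integrable_mul_bounded.
  under [in X in _ <-> X]eq_Rintegral do rewrite mulrBl.
  rewrite RintegralB// /Rintegral integral_indicM// integral_in_indic.
  have fin1 : P (A `&` D) \is a fin_num by apply: fin_num_measure; exact: measurableI.
  have fin2 : (\int[P]_w (f w * \1_D w)%:E)%E \is a fin_num by exact: integrable_fin_num.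
  split=> [->|/eqP]; first by rewrite subrr.
  by rewrite subr_eq0 => /eqP; rewrite -{2}(fineK fin1) -{2}(fineK fin2) => ->.
split=> [[_ _ fD] D GD|fD]; first by apply/(H _ (measurable_generated GD)); exact: fD.
split=> // D GD; apply/(H _ (measurable_generated GD)); exact: fD.
Qed.

(** The version is a Radon-Nikodym derivative, with respect to [P] restricted to [G], of the charge
    sending [B] to the probability of its intersection with [A]. *)
Lemma cond_prob_exists A : measurable A -> exists f, is_cond_prob P G A f.
Proof.
move=> mA.
(* Pushing forward along the identity into [T] equipped with [G] restricts measures to [G]. *)
have mid : measurable_fun setT (id : T -> g_sigma_algebraType gens).
  by move=> _ B mB; rewrite setTI; exact: measurable_generated.
pose X : {mfun T >-> g_sigma_algebraType gens} :=
  MeasurableFun.Pack (MeasurableFun.Class (isMeasurableFun.Build _ _ _ _ _ mid)).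
pose mu := distribution P X.
have iA : P.-integrable setT (EFin \o (\1_A : T -> R)).
  by apply: integrable_bounded; exact: bounded_rv_indic.
pose nu := measure_function_pushforward__canonical__charge_Charge (induced_charge iA) mid.
have nuE B : measurable B -> nu B = P (A `&` B).
  move=> mB; rewrite /nu /= /pushforward /induced_charge preimage_id.
  have mB' : d.-measurable B by exact: measurable_generated.
  by rewrite integral_in_indic integral_indicM.
have dom : nu `<< mu.
  apply/null_content_dominatesP => B mB muB0; rewrite nuE//.
  have mB' : d.-measurable B by exact: measurable_generated.
  apply/eqP; rewrite -measure_le0 -[leRHS]muB0 /mu /= /distribution /pushforward preimage_id.
  by apply: (@le_measure _ _ _ P); [apply/mem_set; exact: measurableI|exact/mem_set|exact: subIsetr].
have fin w : Radon_Nikodym nu mu w \is a fin_num by exact: Radon_Nikodym_fin_num.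
have inu := Radon_Nikodym_integrable dom.
have mRN : measurable_fun setT (Radon_Nikodym nu mu) := measurable_int mu inu.
have e : EFin \o (fine \o Radon_Nikodym nu mu) = Radon_Nikodym nu mu.
  by apply/funext => w /=; rewrite fineK.
have iP : P.-integrable setT (EFin \o (fine \o Radon_Nikodym nu mu)).
  apply/integrableP; split.
    by rewrite e; exact: (measurable_comp measurableT (subsetT _) mRN mid).
  have /integrableP[_] := inu; rewrite ge0_integral_pushforward//.
    by rewrite e preimage_id.
  exact: measurableT_comp.
exists (fine \o Radon_Nikodym nu mu); split => //.
  move=> B mB.
  have mf : measurable_fun setT (fine \o Radon_Nikodym nu mu).
    by apply: measurableT_comp.
  by have := mf measurableT B mB; rewrite setTI.
move=> B GB; have mB : measurable (B : set (g_sigma_algebraType gens)) by [].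
rewrite -nuE// (Radon_Nikodym_integral dom mB).
rewrite [RHS](@integral_pushforward _ _ _ _ _ _ mid P B)//.
  by apply: eq_integral => w _; rewrite /= fineK.
by rewrite -e; apply: (integrableS measurableT) => //; exact: measurable_generated.
Qed.

(** A bounded version keeps later products integrable. Any version lies in [[0, 1]] almost surely,
    so clipping alters it on a null set only. *)
Lemma cond_prob_clip A f : measurable A -> is_cond_prob P G A f ->
  exists f', [/\ is_cond_prob P G A f', bounded_rv f' & {ae P, forall w, f w = f' w}].
Proof.
move=> mA cf; have mf := is_cond_prob_measurable cf.
have [Gf fi _] := cf.
move/(is_cond_probP mA Gf fi) : (cf) => f0.
pose clip (y : R) := Num.max (Num.min y 1) 0.
have mclip : measurable_fun setT clip.
  by apply: measurable_maxr => //; apply: measurable_minr.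
have bclip y : 0 <= clip y <= 1.
  by rewrite /clip le_max lexx orbT /= ge_max ge_min lexx orbT ler01.
have bf' : bounded_rv (clip \o f).
  split; first exact: measurableT_comp.
  by exists 1 => w; have /andP[c0 c1] := bclip (f w); rewrite ger0_norm.
have Gf' (B : set R) : measurable B -> G ((clip \o f) @^-1` B).
  move=> mB; rewrite comp_preimage; apply: Gf.
  by rewrite -[X in measurable X]setTI; exact: mclip.
pose U : set T := f @^-1` `]1, +oo[%classic.
pose L : set T := f @^-1` `]-oo, 0[%classic.
have GU : G U by exact: Gf.
have GL : G L by exact: Gf.
have mU := measurable_generated GU; have mL := measurable_generated GL.
have bU : bounded_rv (\1_U : T -> R) by exact: bounded_rv_indic.
have bL : bounded_rv (\1_L : T -> R) by exact: bounded_rv_indic.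
have bA : bounded_rv (\1_A : T -> R) by exact: bounded_rv_indic.
have indic01 (D : set T) w : 0 <= (\1_D w : R) <= 1.
  by rewrite indicE ler0n /= lern1 leq_b1.
(* The excess is written through [1_A - f], whose integrals over [U] and [L] vanish; what remains,
   [(1_A - 1) 1_U - 1_A 1_L], is nonpositive. *)
have e w : `|f w - clip (f w)| = ((\1_A w - 1) * \1_U w - (\1_A w - f w) * \1_U w) +
    ((\1_A w - f w) * \1_L w - \1_A w * \1_L w).
  have -> : ((\1_A w - 1) * \1_U w - (\1_A w - f w) * \1_U w) +
    ((\1_A w - f w) * \1_L w - \1_A w * \1_L w) = (f w - 1) * \1_U w - f w * \1_L w by ring.
  have -> : (\1_U w : R) = (1 < f w)%R%:R.
    by rewrite indicE; congr (nat_of_bool _)%:R; apply/idP/idP;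
      [move/set_mem|move=> ?; apply/mem_set]; rewrite /U /= in_itv /= andbT.
  have -> : (\1_L w : R) = (f w < 0)%R%:R.
    by rewrite indicE; congr (nat_of_bool _)%:R; apply/idP/idP;
      [move/set_mem|move=> ?; apply/mem_set]; rewrite /L /= in_itv /=.
  rewrite /clip; case: (ltP 1 (f w)) => h1.
    rewrite max_l ?ler01// ltNge (le_trans ler01 (ltW h1)) /= mulr1 mulr0 subr0.
    by rewrite gtr0_norm// subr_gt0.
  case: (ltP (f w) 0) => h2.
    by rewrite subr0 mulr0 sub0r mulr1 ltr0_norm.
  by rewrite subrr normr0 !mulr0 subrr.
have iAf := integrable_indic_sub mA fi.
have bA1 : bounded_rv (fun w => \1_A w - 1 : R).
  by apply: bounded_rvD => //; exact: bounded_rv_cst.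
have i1 : P.-integrable setT (EFin \o (fun w => (\1_A w - 1) * \1_U w)).
  by apply: integrable_bounded; exact: bounded_rvM.
have i2 := integrable_mul_bounded iAf bU.
have i3 := integrable_mul_bounded iAf bL.
have i4 : P.-integrable setT (EFin \o (fun w => \1_A w * \1_L w)).
  by apply: integrable_bounded; exact: bounded_rvM.
have ae : {ae P, forall w, f w = (clip \o f) w}.
  have mg : measurable_fun setT (fun w => f w - clip (f w)).
    by apply: measurable_funB => //; exact: measurableT_comp.
  have ig : P.-integrable setT (EFin \o (fun w => f w - clip (f w))).
    have -> : EFin \o (fun w => f w - clip (f w)) = ((EFin \o f) \- (EFin \o (clip \o f)))%E.
      by apply/funext => w /=; rewrite EFinB.
    by apply: integrableB => //; exact: integrable_bounded.
  have le0 : \int[P]_w `|f w - clip (f w)| <= 0.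
    under eq_Rintegral do rewrite e.
    rewrite RintegralD//; last 2 first.
    - by apply: eq_integrable (integrableB measurableT i1 i2) => // w _ /=; rewrite EFinB.
    - by apply: eq_integrable (integrableB measurableT i3 i4) => // w _ /=; rewrite EFinB.
    rewrite !RintegralB// !f0// subr0 sub0r subr_le0.
    apply: (@le_trans _ _ 0); last first.
      by apply: Rintegral_ge0 => w _; rewrite mulr_ge0.
    apply: (@le_trans _ _ (\int[P]_w (0 : R))); last by rewrite Rintegral_cst// mul0r.
    apply: le_Rintegral => //; first exact: finite_measure_integrable_cst.
  have eq0 : (\int[P]_w `|(f w - clip (f w))%:E| = 0)%E.
    have fin : (\int[P]_w `|(f w - clip (f w))%:E|)%E \is a fin_num.
      by apply: integrable_fin_num => //; exact: integrable_abse.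
    rewrite -(fineK fin); congr EFin; apply/eqP; rewrite eq_le.
    by apply/andP; split; [exact: le0|exact/fine_ge0/integral_ge0].
  have mg' : measurable_fun setT (EFin \o (fun w => f w - clip (f w))) by exact/measurable_EFinP.
  have [/(_ eq0) + _] := ae_eq_integral_abs P measurableT mg'.
  apply: filterS => w /(_ I) /= [] fc; apply/eqP.
  by rewrite -subr_eq0 fc.
exists (clip \o f); split => //.
apply/is_cond_probP => //; first exact: integrable_bounded.
move=> D GD; rewrite -[RHS](f0 D GD) /Rintegral; congr fine.
have mD := measurable_generated GD.
have bD : bounded_rv (\1_D : T -> R) by exact: bounded_rv_indic.
apply: ae_eq_integral => //.
- by apply/measurable_EFinP; apply: measurable_funM => //; apply: measurable_funB => //;
    case: bf'.
- by apply/measurable_EFinP; apply: measurable_funM => //; exact: measurable_funB.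
- by move: ae; apply: filterS => w -> _.
Qed.

End ConditionalProbability.

(** * Linear families of centered Gaussian variables *)

Section SigmaFamily.
Context d (T : measurableType d) (R : realType).
Implicit Types (V W : set (T -> R)) (D E : set T).

Lemma sigma_familyS V W : V `<=` W -> sigma_family V `<=` sigma_family W.
Proof.
by move=> VW; apply: sub_sigma_algebra2 => _ [L [B [/VW WL mB ->]]]; exists L, B.
Qed.

Lemma sigma_family_preimage V L (B : set R) : V L -> measurable B ->
  sigma_family V (L @^-1` B).
Proof. by move=> VL mB; apply: sub_sigma_algebra; exists L, B. Qed.

Lemma sigma_familyI V D E : sigma_family V D -> sigma_family V E ->
  sigma_family V (D `&` E).
Proof.
rewrite /sigma_family; set gens := (X in <<s X >>).
exact: (@measurableI _ (g_sigma_algebraType gens)).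
Qed.

Lemma sigma_familyT V : sigma_family V setT.
Proof.
rewrite /sigma_family; set gens := (X in <<s X >>).
exact: (@measurableT _ (g_sigma_algebraType gens)).
Qed.

Lemma sigma_family_funM V (f g : T -> R) :
  (forall B : set R, measurable B -> sigma_family V (f @^-1` B)) ->
  (forall B : set R, measurable B -> sigma_family V (g @^-1` B)) ->
  forall B : set R, measurable B -> sigma_family V ((fun w => f w * g w) @^-1` B).
Proof.
rewrite /sigma_family; set gens := (X in <<s X >>) => Vf Vg B mB.
have mf : measurable_fun setT (f : g_sigma_algebraType gens -> R).
  by move=> _ E mE; rewrite setTI; exact: Vf.
have mg : measurable_fun setT (g : g_sigma_algebraType gens -> R).
  by move=> _ E mE; rewrite setTI; exact: Vg.
have mfg := measurable_funM mf mg.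
by have := mfg measurableT B mB; rewrite setTI.
Qed.

Lemma linear_family_sum V I (r : seq I) (v : I -> T -> R) : linear_family V ->
  (forall i, V (v i)) -> V (fun w => \sum_(i <- r) v i w).
Proof.
move=> [V0 _ VD] Vv; elim: r => [|i r IH].
  by under eq_fun do rewrite big_nil.
by under eq_fun do rewrite big_cons; exact: VD.
Qed.

Lemma linear_familyB V X Y : linear_family V -> V X -> V Y -> V (fun w => X w - Y w).
Proof.
move=> [_ VZ VD] VX VY.
have -> : (fun w => X w - Y w) = (fun w => X w + (-1) * Y w).
  by apply/funext => w; rewrite mulN1r.
exact/VD/VZ.
Qed.

End SigmaFamily.

Section GaussianFamily.
Context d (T : measurableType d) (R : realType) (P : probability T R).
Variable H : set (T -> R).
Hypothesis linH : linear_family H.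
Hypothesis gaussH : forall L, H L -> gaussian_rv P L.
Hypothesis meanH : forall L, H L -> \int[P]_w L w = 0.
Implicit Types (V W : set (T -> R)) (L X Y Z : T -> R) (D : set T).

(** Members of [H] are centered, so on [H] this is the covariance. *)
Definition ip X Y : R := \int[P]_w (X w * Y w).

Lemma measurable_family L : H L -> measurable_fun setT L.
Proof. by move=> /gaussH[]. Qed.

Lemma square_integrable_family L : H L -> P.-integrable setT (EFin \o (fun w => L w * L w)).
Proof.
by move=> HL; apply: eq_integrable (gaussian_rv_square_integrable (gaussH HL)).
Qed.

Lemma integrable_family_mul X Y : H X -> H Y ->
  P.-integrable setT (EFin \o (fun w => X w * Y w)).
Proof.
move=> HX HY.
have iXY := integrableD measurableT (square_integrable_family HX) (square_integrable_family HY).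
apply: le_integrable iXY => //.
  by apply/measurable_EFinP; apply: measurable_funM; exact: measurable_family.
move=> w _; rewrite /= lee_fin ler_norml.
have h1 := sqr_ge0 (X w - Y w); have h2 := sqr_ge0 (X w + Y w).
have h3 := sqr_ge0 (X w); have h4 := sqr_ge0 (Y w).
rewrite (@ger0_norm _ (_ + _)); last by rewrite -!expr2 addr_ge0.
rewrite !expr2 in h1 h2 h3 h4.
by apply/andP; split; lra.
Qed.

Lemma integrable_family L : H L -> P.-integrable setT (EFin \o L).
Proof.
move=> HL.
have i1 : P.-integrable setT (EFin \o cst (1 : R)) by exact: finite_measure_integrable_cst.
have iL := integrableD measurableT (square_integrable_family HL) i1.
apply: le_integrable iL => //; first exact/measurable_EFinP/measurable_family.
move=> w _; rewrite /= lee_fin.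
rewrite [leRHS]ger0_norm; last by rewrite -!expr2 addr_ge0// sqr_ge0.
have h1 := sqr_ge0 (L w - 1); have h2 := sqr_ge0 (L w + 1).
have h3 := sqr_ge0 (L w).
rewrite !expr2 in h1 h2 h3.
by rewrite ler_norml; apply/andP; split; lra.
Qed.

Lemma ipC X Y : ip X Y = ip Y X.
Proof. by apply: eq_Rintegral => w _; rewrite mulrC. Qed.

Lemma ipDl X Y Z : H X -> H Y -> H Z ->
  ip (fun w => X w + Y w) Z = ip X Z + ip Y Z.
Proof.
move=> HX HY HZ; rewrite /ip -RintegralD//; try exact: integrable_family_mul.
by apply: eq_Rintegral => w _; rewrite mulrDl.
Qed.

Lemma ipZl c X Y : H X -> H Y -> ip (fun w => c * X w) Y = c * ip X Y.
Proof.
move=> HX HY; rewrite /ip -RintegralZl//; last exact: integrable_family_mul.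
by apply: eq_Rintegral => w _; rewrite mulrA.
Qed.

Lemma ipDr X Y Z : H X -> H Y -> H Z ->
  ip X (fun w => Y w + Z w) = ip X Y + ip X Z.
Proof. by move=> HX HY HZ; rewrite ipC ipDl// ipC [ip Z X]ipC. Qed.

Lemma ipZr c X Y : H X -> H Y -> ip X (fun w => c * Y w) = c * ip X Y.
Proof. by move=> HX HY; rewrite ipC ipZl// ipC. Qed.

Let HD X Y : H X -> H Y -> H (fun w => X w + Y w).
Proof. by case: linH => _ _; apply. Qed.

Let HZ c X : H X -> H (fun w => c * X w).
Proof. by case: linH => _ + _; apply. Qed.

Lemma family_cos L th : H L ->
  \int[P]_w cos (L w + th) = cos th * expR (- ip L L / 2).
Proof.
move=> HL; rewrite (gaussian_rv_cos th (gaussH HL) (meanH HL)).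
by congr (_ * expR (- _ / 2)); apply: eq_Rintegral => w _; rewrite expr2.
Qed.

(** Orthogonality makes the variances add, so the exponential factors multiply. *)
Lemma family_cosD Z L th : H Z -> H L -> ip Z L = 0 ->
  \int[P]_w cos (Z w + L w + th) = expR (- ip Z Z / 2) * \int[P]_w cos (L w + th).
Proof.
move=> HZ' HL ZL; rewrite (family_cos th (HD HZ' HL)) (family_cos th HL).
rewrite mulrCA -expRD; congr (_ * expR _).
rewrite ipDl ?ipDr//; [|exact: HD..].
by rewrite [ip L Z]ipC ZL; ring.
Qed.

Lemma integrable_cos L th : H L -> P.-integrable setT (EFin \o (fun w => cos (L w + th))).
Proof.
by move=> HL; apply: integrable_bounded; apply: bounded_rv_cos; exact: measurable_family.
Qed.

Section Orthogonal.
Variable V : set (T -> R).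
Hypotheses (linV : linear_family V) (VH : V `<=` H).

Let VD X Y : V X -> V Y -> V (fun w => X w + Y w).
Proof. by case: linV => _ _; apply. Qed.

Let VZ c X : V X -> V (fun w => c * X w).
Proof. by case: linV => _ + _; apply. Qed.

(* For [Z] independent of [V], [expR (- ip Z Z / 2) * cos (Y + th)] is the
   conditional expectation of [cos (Y + Z + th)] given [V]. *)
Lemma cos_orthogonal Y Z th D : V Y -> H Z -> (forall L, V L -> ip Z L = 0) ->
  sigma_family V D ->
  \int[P]_w ((cos (Y w + Z w + th) - expR (- ip Z Z / 2) * cos (Y w + th)) * \1_D w) = 0.
Proof.
move=> VY HZ' ZV; move: D; set k := expR _.
have HYZ : H (fun w => Y w + Z w) by apply: HD => //; exact: VH.
have mV L : V L -> measurable_fun setT L by move=> VL; exact/measurable_family/VH.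
have bpsi : bounded_rv (fun w => cos (Y w + Z w + th) - k * cos (Y w + th) : R).
  have -> : (fun w => cos (Y w + Z w + th) - k * cos (Y w + th)) =
    (fun w => cos (Y w + Z w + th) + (- k) * cos (Y w + th)).
    by apply/funext => w; rewrite mulNr.
  apply: bounded_rvD; first exact/bounded_rv_cos/measurable_family.
  by apply: bounded_rvM; [exact: bounded_rv_cst|exact/bounded_rv_cos/mV].
apply: Rintegral0_sigma_family => //; first exact: integrable_bounded.
move=> L th' VL.
have VYL := VD VY VL; have VYL' := VD VY (VZ (-1) VL).
pose A1 (w : T) := cos (Z w + (Y w + L w) + (th + th')).
pose A2 (w : T) := cos (Z w + (Y w + -1 * L w) + (th - th')).
pose B1 (w : T) := cos (Y w + L w + (th + th')).
pose B2 (w : T) := cos (Y w + -1 * L w + (th - th')).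
(* The product-to-sum formula leaves [Z + (Y + L)] and [Z + (Y - L)], where [Y + L] and [Y - L] lie
   in [V] and hence are orthogonal to [Z]. *)
have -> : \int[P]_w ((cos (Y w + Z w + th) - k * cos (Y w + th)) * cos (L w + th')) =
    \int[P]_w (2^-1 * (A1 w - k * B1 w) + 2^-1 * (A2 w - k * B2 w)).
  apply: eq_Rintegral => w _; rewrite mulrBl -mulrA !cosM /A1 /A2 /B1 /B2.
  have -> : Y w + Z w + th + (L w + th') = Z w + (Y w + L w) + (th + th') by ring.
  have -> : Y w + Z w + th - (L w + th') = Z w + (Y w + -1 * L w) + (th - th') by ring.
  have -> : Y w + th + (L w + th') = Y w + L w + (th + th') by ring.
  have -> : Y w + th - (L w + th') = Y w + -1 * L w + (th - th') by ring.
  by ring.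
have iA1 : P.-integrable setT (EFin \o A1).
  by apply: (@integrable_cos (fun w => Z w + (Y w + L w))); apply: HD => //; exact: VH.
have iA2 : P.-integrable setT (EFin \o A2).
  by apply: (@integrable_cos (fun w => Z w + (Y w + -1 * L w))); apply: HD => //; exact: VH.
have iB1 : P.-integrable setT (EFin \o (fun w => k * B1 w)).
  by apply: (@integrableZl _ _ _ _ _ measurableT k (EFin \o B1)); apply: integrable_cos; exact: VH.
have iB2 : P.-integrable setT (EFin \o (fun w => k * B2 w)).
  by apply: (@integrableZl _ _ _ _ _ measurableT k (EFin \o B2)); apply: integrable_cos; exact: VH.
have iAB1 : P.-integrable setT (EFin \o (fun w => A1 w - k * B1 w)).
  by apply: eq_integrable (integrableB measurableT iA1 iB1) => // w _ /=; rewrite EFinB.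
have iAB2 : P.-integrable setT (EFin \o (fun w => A2 w - k * B2 w)).
  by apply: eq_integrable (integrableB measurableT iA2 iB2) => // w _ /=; rewrite EFinB.
rewrite RintegralD//; last 2 first.
- exact: (@integrableZl _ _ _ _ _ measurableT 2^-1 _ iAB1).
- exact: (@integrableZl _ _ _ _ _ measurableT 2^-1 _ iAB2).
rewrite !RintegralZl// !RintegralB//.
rewrite !RintegralZl//; [|by apply: integrable_cos; exact: VH..].
rewrite /A1 /A2 (@family_cosD Z (fun w => Y w + L w))//; [|exact: VH|exact: ZV].
rewrite (@family_cosD Z (fun w => Y w + -1 * L w))//; [|exact: VH|exact: ZV].
by rewrite !subrr !mulr0 addr0.
Qed.

(* [Z] is independent of [sigma_family V]: its characteristic function does not
   change when the law is weighted by [\1_D]. *)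
Lemma Rintegral0_orthogonal Z D : H Z -> (forall L, V L -> ip Z L = 0) ->
  sigma_family V D -> \int[P]_w (Z w * \1_D w) = 0.
Proof.
move=> HZ' ZV VD'.
have mD : measurable D.
  move: VD'; apply: measurable_generated => _ [L [B [VL mB ->]]].
  by rewrite -[X in measurable X]setTI; apply: (measurable_family (VH VL)).
have bD : bounded_rv (\1_D : T -> R) by exact: bounded_rv_indic.
have iD := integrable_bounded P bD.
pose q := \int[P]_w (\1_D w : R).
have bpsi : bounded_rv (fun w => \1_D w - q : R).
  by apply: bounded_rvD => //; exact: bounded_rv_cst.
have ipsi := integrable_bounded P bpsi.
have iZ : P.-integrable setT (EFin \o Z) by exact: integrable_family.
pose Lam := [set L | exists t, L = (fun w => t * Z w)].
have linLam : linear_family Lam.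
  split.
  - by exists 0; apply/funext => w; rewrite mul0r.
  - by move=> c _ [t ->]; exists (c * t); apply/funext => w; rewrite mulrA.
  - by move=> _ _ [t ->] [u ->]; exists (t + u); apply/funext => w; rewrite mulrDl.
have V0 : V (fun=> 0) by case: linV.
(* By [cos_orthogonal] with [Y = 0], weighting by [1_D] multiplies the integral of [cos (t Z + th)]
   by [q]. *)
have step t th : \int[P]_w ((\1_D w - q) * cos (t * Z w + th)) = 0.
  have HtZ := HZ t HZ'.
  have ic := integrable_cos th HtZ.
  have tZV L : V L -> ip (fun w => t * Z w) L = 0.
    by move=> VL; rewrite ipZl ?ZV ?mulr0//; exact: VH.
  have := cos_orthogonal th V0 HtZ tZV VD'.
  rewrite add0r; set k := expR _ * _.
  have -> : \int[P]_w ((cos (0 + t * Z w + th) - k) * \1_D w) =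
      \int[P]_w (cos (t * Z w + th) * \1_D w - k * \1_D w).
    by apply: eq_Rintegral => w _; rewrite add0r mulrBl.
  have i1 := integrable_mul_bounded ic bD.
  have i2 : P.-integrable setT (EFin \o (fun w => k * \1_D w)).
    exact: (@integrableZl _ _ _ _ _ measurableT k _ iD).
  rewrite RintegralB// RintegralZl// -/q => /eqP; rewrite subr_eq0 => /eqP e.
  have -> : \int[P]_w ((\1_D w - q) * cos (t * Z w + th)) =
      \int[P]_w (cos (t * Z w + th) * \1_D w - q * cos (t * Z w + th)).
    by apply: eq_Rintegral => w _; ring.
  rewrite RintegralB//; last exact: (@integrableZl _ _ _ _ _ measurableT q _ ic).
  by rewrite RintegralZl// e (family_cos th HtZ) /k; ring.
have ipsiZ : P.-integrable setT (EFin \o (fun w => (\1_D w - q) * Z w)).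
  by apply: eq_integrable (integrable_mul_bounded iZ bpsi) => // w _ /=; rewrite mulrC.
(* [1_D - q] is orthogonal to the events generated by [Z], hence to [Z]; the term with [q] then
   drops out because [Z] is centered. *)
have : \int[P]_w ((\1_D w - q) * Z w) = 0.
  apply: Rintegral0_mul => //; first exact: measurable_family.
  move=> B mB; apply: (Rintegral0_sigma_family linLam) => //.
  - by move=> _ [t ->]; exact/measurable_family/HZ.
  - by move=> _ th [t ->]; exact: step.
  - apply: sigma_family_preimage => //.
    by exists 1; apply/funext => w; rewrite mul1r.
have -> : \int[P]_w ((\1_D w - q) * Z w) = \int[P]_w (Z w * \1_D w - q * Z w).
  by apply: eq_Rintegral => w _; ring.
rewrite RintegralB//; last 2 first.
- exact: integrable_mul_bounded.
- exact: (@integrableZl _ _ _ _ _ measurableT q _ iZ).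
by rewrite RintegralZl// (meanH HZ') mulr0 subr0.
Qed.

End Orthogonal.

(** * Conditional independence inside the Gaussian family *)

Lemma sigma_family_measurable V : V `<=` H ->
  forall D, [set D | exists L (B : set R), [/\ V L, measurable B & D = L @^-1` B]] D ->
  measurable D.
Proof.
move=> VH _ [L [B [VL mB ->]]].
by rewrite -[X in measurable X]setTI; apply: (measurable_family (VH _ VL)).
Qed.

(* A version [f] of [P(A | G)] also serves as [P(A | G, D)]. *)
Lemma cond_indep_indic V A D f : V `<=` H -> measurable A -> measurable D ->
  is_cond_prob P (sigma_family V) A f -> bounded_rv f ->
  cond_indep P (sigma_family V) A D ->
  \int[P]_w ((\1_A w - f w) * \1_D w) = 0.
Proof.
move=> VH mA mD cf [mf fM]; have mV := sigma_family_measurable VH.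
move=> [f1 [g [h [cf1 cg ch fgh]]]].
have [Gf fi _] := cf; have [Gf1 f1i _] := cf1; have [Gg gi _] := cg.
have [Gh hi _] := ch.
have /(is_cond_probP mV mA Gf fi) f0 := cf.
have /(is_cond_probP mV mA Gf1 f1i) f10 := cf1.
have /(is_cond_probP mV mD Gg gi) g0 := cg.
have mAD : measurable (A `&` D) by exact: measurableI.
have /(is_cond_probP mV mAD Gh hi) h0 := ch.
have mf1 := is_cond_prob_measurable mV cf1.
have mg := is_cond_prob_measurable mV cg.
have mh := is_cond_prob_measurable mV ch.
have bf : bounded_rv f by split.
have bA : bounded_rv (\1_A : T -> R) by exact: bounded_rv_indic.
have bD : bounded_rv (\1_D : T -> R) by exact: bounded_rv_indic.
have iAf := integrable_indic_sub mA fi.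
have iAf1 := integrable_indic_sub mA f1i.
have iDg := integrable_indic_sub mD gi.
have e1 : \int[P]_w ((\1_A w - f w) * g w) = 0.
  apply: Rintegral0_mul => //.
    have := integrable_mul_bounded gi (bounded_rvD bA (bounded_rvM (bounded_rv_cst _ (-1)) bf)).
    by apply: eq_integrable => // w _ /=; congr (_%:E); ring.
  by move=> B mB; apply: f0; exact: Gg.
have e2 : \int[P]_w ((\1_D w - g w) * f w) = 0.
  apply: Rintegral0_mul => //; first exact: integrable_mul_bounded.
  by move=> B mB; apply: g0; exact: Gf.
(* The versions [f1] and [g] need not be bounded; their product is integrable because it agrees
   almost everywhere with [h]. *)
have ifg : P.-integrable setT (EFin \o (fun w => f1 w * g w)).
  have mfg : measurable_fun setT (EFin \o (fun w => f1 w * g w)).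
    by apply/measurable_EFinP; exact: measurable_funM.
  apply/integrableP; split => //.
  have /integrableP[_] := hi; congr (_ < _)%E; apply: ae_eq_integral => //.
  - by apply: measurableT_comp => //; exact/measurable_EFinP.
  - exact: measurableT_comp.
  - by move: fgh; apply: filterS => w /= -> _.
have iAg := integrable_mul_bounded gi bA.
have e3 : \int[P]_w ((\1_A w - f1 w) * g w) = 0.
  apply: Rintegral0_mul => //.
    apply: eq_integrable (integrableB measurableT iAg ifg) => // w _ /=.
    by rewrite -EFinB; congr (_%:E); ring.
  by move=> B mB; apply: f10; exact: Gg.
have e4 : \int[P]_w (\1_A w * \1_D w - f1 w * g w) = 0.
  rewrite -[RHS](h0 _ (@sigma_familyT _ _ _ V)) /Rintegral; congr fine.
  apply: ae_eq_integral => //.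
  - apply/measurable_EFinP; apply: measurable_funB; last exact: measurable_funM.
    by apply: measurable_funM; exact: measurable_indic.
  - apply/measurable_EFinP; apply: measurable_funM; last exact: measurable_indic.
    by apply: measurable_funB => //; exact: measurable_indic.
  - by move: fgh; apply: filterS => w -> _; rewrite indicI indicT mulr1.
have iAD := integrable_bounded P (bounded_rvM bA bD).
have i1 : P.-integrable setT (EFin \o (fun w => (\1_A w - f w) * g w)).
  have := integrable_mul_bounded gi (bounded_rvD bA (bounded_rvM (bounded_rv_cst _ (-1)) bf)).
  by apply: eq_integrable => // w _ /=; congr (_%:E); ring.
have i2 : P.-integrable setT (EFin \o (fun w => (\1_D w - g w) * f w)).
  exact: integrable_mul_bounded.
have i3 : P.-integrable setT (EFin \o (fun w => (\1_A w - f1 w) * g w)).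
  apply: eq_integrable (integrableB measurableT iAg ifg) => // w _ /=.
  by rewrite -EFinB; congr (_%:E); ring.
have i4 : P.-integrable setT (EFin \o (fun w => \1_A w * \1_D w - f1 w * g w)).
  by apply: eq_integrable (integrableB measurableT iAD ifg) => // w _ /=; rewrite EFinB.
have i5 : P.-integrable setT
    (EFin \o (fun w => (\1_A w - f w) * g w - (\1_D w - g w) * f w)).
  by apply: eq_integrable (integrableB measurableT i1 i2) => // w _ /=; rewrite EFinB.
have i6 : P.-integrable setT (EFin \o
    (fun w => \1_A w * \1_D w - f1 w * g w - (\1_A w - f1 w) * g w)).
  by apply: eq_integrable (integrableB measurableT i4 i3) => // w _ /=; rewrite EFinB.
(* The integrand is regrouped into the four terms whose integrals vanish by [e1] to [e4]. *)
have -> : \int[P]_w ((\1_A w - f w) * \1_D w) =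
  \int[P]_w (((\1_A w - f w) * g w - (\1_D w - g w) * f w) +
    (\1_A w * \1_D w - f1 w * g w - (\1_A w - f1 w) * g w)).
  by apply: eq_Rintegral => w _; ring.
rewrite RintegralD// (RintegralB measurableT i1 i2) (RintegralB measurableT i4 i3).
by rewrite e1 e2 e3 e4 !subr0 addr0.
Qed.

(* With [s := Y - b] the residual of [Y], conditional independence gives
   [E[1_A s] = E[P(A | V) s]], which vanishes since [s] is independent of [V];
   then let [X] be approximated by linear combinations of indicators. *)
Lemma cond_indep_orthogonal V X Y b : linear_family V -> V `<=` H -> H X -> H Y -> V b ->
  (forall L, V L -> ip (fun w => Y w - b w) L = 0) ->
  (forall B B' : set R, measurable B -> measurable B' ->
    cond_indep P (sigma_family V) (X @^-1` B) (Y @^-1` B')) ->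
  ip X (fun w => Y w - b w) = 0.
Proof.
move=> linV VH HX HY Vb sV ci; have mV := sigma_family_measurable VH.
have HS : H (fun w => Y w - b w).
  have -> : (fun w => Y w - b w) = (fun w => Y w + (-1) * b w).
    by apply/funext => w; rewrite mulN1r.
  by apply: HD => //; apply: HZ; exact: VH.
set S := (fun w => Y w - b w) in sV HS *.
have mX := measurable_family HX; have mY := measurable_family HY.
rewrite ipC; apply: Rintegral0_mul; [exact: integrable_family|exact: mX| |].
  exact: integrable_family_mul.
move=> B mB; set A := X @^-1` B.
have mA : measurable A by rewrite -[X in measurable X]setTI; exact: mX.
have [f1 cf1] := cond_prob_exists P mV mA.
have [f [cf bf _]] := cond_prob_clip mV mA cf1.
have [Gf fi _] := cf.
have /(is_cond_probP mV mA Gf fi) f0 := cf.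
have bA : bounded_rv (\1_A : T -> R) by exact: bounded_rv_indic.
have bpsi : bounded_rv (fun w => \1_A w - f w).
  have := bounded_rvD bA (bounded_rvM (bounded_rv_cst _ (-1)) bf).
  by congr bounded_rv; apply/funext => w; rewrite mulN1r.
have ipsi := integrable_bounded P bpsi.
have iL L : H L -> P.-integrable setT (EFin \o (fun w => (\1_A w - f w) * L w)).
  move=> HL; apply: eq_integrable (integrable_mul_bounded (integrable_family HL) bpsi) => //.
  by move=> w _ /=; rewrite mulrC.
(* Conditional independence makes [1_A - f] orthogonal to [Y]; orthogonality to [b] below is the
   defining property of [f]. *)
have eY : \int[P]_w ((\1_A w - f w) * Y w) = 0.
  apply: Rintegral0_mul => //; first exact: iL.
  move=> B' mB'; apply: (cond_indep_indic VH mA _ cf bf); last exact: ci.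
  by rewrite -[X in measurable X]setTI; exact: mY.
have eb : \int[P]_w ((\1_A w - f w) * b w) = 0.
  have Hb := VH _ Vb.
  apply: Rintegral0_mul => //; [exact: measurable_family|exact: iL|].
  by move=> B' mB'; apply: f0; exact: sigma_family_preimage.
have eS : \int[P]_w ((\1_A w - f w) * S w) = 0.
  under eq_Rintegral do rewrite /S mulrBr.
  by rewrite RintegralB// ?eY ?eb ?subr0//; apply: iL => //; exact: VH.
have iS := integrable_family HS.
(* [f] is measurable for the sigma-field of [V], of which [S] is independent. *)
have ef : \int[P]_w (S w * f w) = 0.
  apply: Rintegral0_mul => //; [by case: bf|exact: integrable_mul_bounded|].
  move=> B' mB'; apply: (Rintegral0_orthogonal linV VH HS sV); exact: Gf.
have -> : \int[P]_w (S w * \1_A w) = \int[P]_w ((\1_A w - f w) * S w + S w * f w).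
  by apply: eq_Rintegral => w _; ring.
rewrite RintegralD//; [by rewrite eS ef addr0|exact: iL|exact: integrable_mul_bounded].
Qed.

(** [V] plays the future with the present, [W] the past with the present, and [U] the present. A
    character of [W] is replaced by its conditional expectation given [V], a multiple of
    [cos (Y + th)]; this is measurable for the sigma-field of [U], hence orthogonal to [1_A - f]. *)
Lemma cond_prob_markov V U W A f : linear_family V -> V `<=` H -> U `<=` V ->
  linear_family W -> W `<=` H ->
  (forall w, W w -> exists Y Z, [/\ w = (fun t => Y t + Z t), U Y, H Z
     & forall L, V L -> ip Z L = 0]) ->
  sigma_family V A -> is_cond_prob P (sigma_family U) A f -> bounded_rv f ->
  forall D, sigma_family W D -> \int[P]_w ((\1_A w - f w) * \1_D w) = 0.
Proof.
move=> linV VH UV linW WH dec VA cf bf.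
have UH : U `<=` H by move=> L /UV /VH.
have mU := sigma_family_measurable UH.
have mA : measurable A by exact: measurable_generated (sigma_family_measurable VH) _ VA.
have [Gf fi _] := cf.
have /(is_cond_probP mU mA Gf fi) f0 := cf.
have bA : bounded_rv (\1_A : T -> R) by exact: bounded_rv_indic.
have bpsi : bounded_rv (fun w => \1_A w - f w).
  have := bounded_rvD bA (bounded_rvM (bounded_rv_cst _ (-1)) bf).
  by congr bounded_rv; apply/funext => w; rewrite mulN1r.
apply: Rintegral0_sigma_family => //.
- by move=> L /WH; exact: measurable_family.
- exact: integrable_bounded.
move=> _ th /dec [Y [Z [-> UY HZ' ZV]]].
have VY := UV _ UY; have HY := VH _ VY.
pose k := expR (- ip Z Z / 2).
pose psi w := cos (Y w + Z w + th) - k * cos (Y w + th).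
have bY : bounded_rv (fun w => cos (Y w + th) : R).
  by apply: bounded_rv_cos; exact: measurable_family.
have bYZ : bounded_rv (fun w => cos (Y w + Z w + th) : R).
  by apply: (@bounded_rv_cos _ _ _ (fun w => Y w + Z w)); apply/measurable_family/HD.
have bpsiW : bounded_rv psi.
  have := bounded_rvD bYZ (bounded_rvM (bounded_rv_cst _ (- k)) bY).
  by congr bounded_rv; apply/funext => w; rewrite mulNr.
have psi0 D : sigma_family V D -> \int[P]_w (psi w * \1_D w) = 0.
  exact: cos_orthogonal.
have eA := psi0 _ VA.
have ef : \int[P]_w (psi w * f w) = 0.
  apply: Rintegral0_mul => //; [exact: integrable_bounded|by case: bf| |].
    exact/integrable_bounded/bounded_rvM.
  by move=> B mB; apply: psi0; apply: (sigma_familyS UV); exact: Gf.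
have eY : \int[P]_w ((\1_A w - f w) * cos (Y w + th)) = 0.
  apply: Rintegral0_mul => //; [exact: integrable_bounded|by case: bY| |].
    exact/integrable_bounded/bounded_rvM.
  move=> B mB; apply: f0.
  have mc : measurable ((fun y : R => cos (y + th)) @^-1` B).
    rewrite -[X in measurable X]setTI.
    have : measurable_fun setT (fun y : R => cos (y + th)).
      apply: measurableT_comp; first exact: continuous_measurable_fun (@continuous_cos R).
      exact: measurable_funD.
    by apply.
  exact: (sigma_family_preimage UY mc).
have i1 := integrable_bounded P (bounded_rvM bpsiW bA).
have i2 := integrable_bounded P (bounded_rvM bpsiW bf).
have i3 := integrable_bounded P (bounded_rvM bpsi bY).
have -> : \int[P]_w ((\1_A w - f w) * cos (Y w + Z w + th)) =
    \int[P]_w (psi w * \1_A w - psi w * f w + k * ((\1_A w - f w) * cos (Y w + th))).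
  by apply: eq_Rintegral => w _; rewrite /psi; ring.
rewrite RintegralD//; last 2 first.
- by apply: eq_integrable (integrableB measurableT i1 i2) => // w _ /=; rewrite EFinB.
- exact: (@integrableZl _ _ _ _ _ measurableT k _ i3).
by rewrite RintegralB// RintegralZl// eA ef eY subrr mulr0 addr0.
Qed.

(** The product [f * g] is a version for the intersection, by the split [1_A 1_B - f g = (1_A - f)
    1_B + (1_B - g) f]: [cond_prob_markov] handles the first term, and the second is orthogonal to
    events of [U] because [f] is measurable for [U]. *)
Lemma cond_indep_markov V U W A B : linear_family V -> V `<=` H -> U `<=` V ->
  linear_family W -> W `<=` H -> U `<=` W ->
  (forall w, W w -> exists Y Z, [/\ w = (fun t => Y t + Z t), U Y, H Z
     & forall L, V L -> ip Z L = 0]) ->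
  sigma_family V A -> sigma_family W B -> cond_indep P (sigma_family U) A B.
Proof.
move=> linV VH UV linW WH UW dec VA WB.
have UH : U `<=` H by move=> L /UV /VH.
have mU := sigma_family_measurable UH.
have mA : measurable A by exact: measurable_generated (sigma_family_measurable VH) _ VA.
have mB : measurable B by exact: measurable_generated (sigma_family_measurable WH) _ WB.
have [f1 cf1] := cond_prob_exists P mU mA.
have [f [cf bf _]] := cond_prob_clip mU mA cf1.
have [g1 cg1] := cond_prob_exists P mU mB.
have [g [cg bg _]] := cond_prob_clip mU mB cg1.
exists f, g, (fun w => f w * g w); split => //; last exact: aeW.
have [Gf fi _] := cf; have [Gg gi _] := cg.
have /(is_cond_probP mU mB Gg gi) g0 := cg.
apply/(is_cond_probP mU) => //; first exact: measurableI.
- exact: sigma_family_funM.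
- exact/integrable_bounded/bounded_rvM.
move=> C UC; have mC : measurable C by exact: measurable_generated mU _ UC.
have bA : bounded_rv (\1_A : T -> R) by exact: bounded_rv_indic.
have bB : bounded_rv (\1_B : T -> R) by exact: bounded_rv_indic.
have bC : bounded_rv (\1_C : T -> R) by exact: bounded_rv_indic.
have bBC : bounded_rv (\1_(B `&` C) : T -> R) by apply: bounded_rv_indic; exact: measurableI.
have bAf : bounded_rv (fun w => \1_A w - f w).
  have := bounded_rvD bA (bounded_rvM (bounded_rv_cst _ (-1)) bf).
  by congr bounded_rv; apply/funext => w; rewrite mulN1r.
have bBg : bounded_rv (fun w => \1_B w - g w).
  have := bounded_rvD bB (bounded_rvM (bounded_rv_cst _ (-1)) bg).
  by congr bounded_rv; apply/funext => w; rewrite mulN1r.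
have e1 : \int[P]_w ((\1_A w - f w) * \1_(B `&` C) w) = 0.
  apply: (cond_prob_markov linV VH UV linW WH dec VA cf bf).
  by apply: sigma_familyI => //; exact: sigma_familyS UC.
have e2 : \int[P]_w ((\1_B w - g w) * \1_C w * f w) = 0.
  apply: Rintegral0_mul => //; [exact/integrable_bounded/bounded_rvM|by case: bf| |].
    by apply/integrable_bounded/bounded_rvM => //; exact: bounded_rvM.
  move=> E mE; rewrite -[RHS](g0 (C `&` f @^-1` E)).
    by apply: eq_Rintegral => w _; rewrite indicI /= mulrA.
  by apply: sigma_familyI => //; exact: Gf.
have -> : \int[P]_w ((\1_(A `&` B) w - f w * g w) * \1_C w) =
   \int[P]_w ((\1_A w - f w) * \1_(B `&` C) w + (\1_B w - g w) * \1_C w * f w).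
  by apply: eq_Rintegral => w _; rewrite !indicI /=; ring.
rewrite RintegralD ?e1 ?e2 ?addr0//; first exact/integrable_bounded/bounded_rvM.
by apply/integrable_bounded/bounded_rvM => //; exact: bounded_rvM.
Qed.


(** * Orthogonal projections *)

Lemma ipBr X Y Z : H X -> H Y -> H Z ->
  ip X (fun w => Y w - Z w) = ip X Y - ip X Z.
Proof.
move=> HX HY HZ'.
have -> : (fun w => Y w - Z w) = (fun w => Y w + (-1) * Z w).
  by apply/funext => w; rewrite mulN1r.
by rewrite ipDr//; [rewrite ipZr// mulN1r|exact: HZ].
Qed.

Lemma ipBl X Y Z : H X -> H Y -> H Z ->
  ip (fun w => X w - Y w) Z = ip X Z - ip Y Z.
Proof. by move=> HX HY HZ'; rewrite ipC ipBr// ipC [ip Z Y]ipC. Qed.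

Lemma ip_sumr X I (r : seq I) (a : I -> R) (v : I -> T -> R) : H X ->
  (forall i, H (v i)) ->
  ip X (fun w => \sum_(i <- r) a i * v i w) = \sum_(i <- r) a i * ip X (v i).
Proof.
move=> HX Hv; elim: r => [|i r IH].
  rewrite big_nil /ip; under eq_Rintegral do rewrite big_nil mulr0.
  by rewrite Rintegral_cst// mul0r.
rewrite big_cons -IH -ipZr// -ipDr//; last 2 first.
- exact: HZ.
- by apply: linear_family_sum => // k; exact: HZ.
by apply: eq_Rintegral => w _; rewrite big_cons.
Qed.

Lemma ip_ge0 X : 0 <= ip X X.
Proof. by apply: Rintegral_ge0 => w _; rewrite -expr2 sqr_ge0. Qed.

(** The degenerate case of the Cauchy-Schwarz inequality: the quadratic [ip (X + t Y) (X + t Y)] in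
    [t] has no constant term and cannot become negative. *)
Lemma ip_eq0 X Y : H X -> H Y -> ip X X = 0 -> ip X Y = 0.
Proof.
move=> HX HY X0; have q0 := ip_ge0 Y; set b := ip X Y; set q := ip Y Y in q0.
(* The denominator [q + 1] is positive even when [q = 0]; at this [t] the quadratic equals
   [- b^2 (q + 2) / (q + 1)^2]. *)
pose t := - b / (q + 1).
have q1 : q + 1 != 0 by rewrite gt_eqF// ltr_wpDl.
have HtY := HZ t HY.
have : ip (fun w => X w + t * Y w) (fun w => X w + t * Y w) * (q + 1) ^+ 2 =
    - (b ^+ 2 * (q + 2)).
  rewrite ipDl ?ipDr ?ipZr ?ipZl//; try exact: HD.
  by rewrite [ip Y X]ipC X0 -/b -/q /t; field.
have := ip_ge0 (fun w => X w + t * Y w); set u := ip _ _ => u0 e.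
have : 0 <= - (b ^+ 2 * (q + 2)) by rewrite -e mulr_ge0// sqr_ge0.
rewrite oppr_ge0 => le0; apply/eqP; rewrite -sqrf_eq0.
have : b ^+ 2 * (q + 2) == 0.
  by rewrite eq_le le0 mulr_ge0 ?sqr_ge0// addr_ge0.
by rewrite mulf_eq0 => /orP[//|]; rewrite gt_eqF// ltr_wpDl.
Qed.

(* Gram-Schmidt; the last clause says that [Y] is in the span of the [v i]. *)
Lemma projection_exists V (I : eqType) (v : I -> T -> R) (s : seq I) X :
  linear_family V -> V `<=` H -> (forall i, i \in s -> V (v i)) -> H X ->
  exists Y, [/\ V Y, forall i, i \in s -> ip (fun w => X w - Y w) (v i) = 0
    & forall Z, H Z -> (forall i, i \in s -> ip Z (v i) = 0) -> ip Z Y = 0].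
Proof.
move=> linV VH; elim: s X => [|i s IH] X Vv HX.
  exists (fun=> 0); split => //; first by case: linV.
  by move=> Z _ _; rewrite /ip; under eq_Rintegral do rewrite mulr0;
    rewrite Rintegral_cst// mul0r.
have Vs k : k \in s -> V (v k) by move=> ks; apply: Vv; rewrite inE ks orbT.
have Vi : V (v i) by apply: Vv; rewrite mem_head.
have Hi := VH _ Vi.
have [Y1 [VY1 o1 s1]] := IH X Vs HX.
have [Y2 [VY2 o2 s2]] := IH (v i) Vs Hi.
have HY1 := VH _ VY1; have HY2 := VH _ VY2.
have VB := @linear_familyB _ _ _ V _ _ linV.
have HB := @linear_familyB _ _ _ H _ _ linH.
(* [r] is the part of [v i] orthogonal to the generators in [s]; the projection [Y1] is corrected
   along it. *)
pose r w := v i w - Y2 w; have Vr : V r by exact: VB.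
have Hr := VH _ Vr.
pose X1 w := X w - Y1 w; have HX1 : H X1 by exact: HB.
(* If [ip r r = 0], division by zero gives [t = 0]; [ip X1 r] is zero as well in that case, so
   orthogonality to [r] still holds. *)
pose t := ip X1 r / ip r r.
have [V0 VZ VD] := linV.
pose Y w := Y1 w + t * r w.
have VY : V Y by apply/VD/VZ.
have HY := VH _ VY; have Htr := HZ t Hr.
have XYE : (fun w => X w - Y w) = (fun w => X1 w - t * r w).
  by apply/funext => w; rewrite /X1 /Y; ring.
have HXY : H (fun w => X w - Y w) by exact: HB.
have os k : k \in s -> ip (fun w => X w - Y w) (v k) = 0.
  move=> ks; have Hk := VH _ (Vs _ ks).
  by rewrite XYE ipBl// ipZl// o1// o2// mulr0 subrr.
have orr : ip (fun w => X w - Y w) r = 0.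
  rewrite XYE ipBl// ipZl// /t; have [q0|q0] := eqVneq (ip r r) 0.
    by rewrite [ip X1 r]ipC (ip_eq0 Hr HX1 q0) mul0r mul0r subrr.
  by rewrite divfK// subrr.
have viE : v i = (fun w => r w + Y2 w) by apply/funext => w; rewrite subrK.
exists Y; split => // [k|Z HZ' Zs].
  rewrite inE => /predU1P[->|]; last exact: os.
  by rewrite viE ipDr// orr s2// addr0.
have Zs' k : k \in s -> ip Z (v k) = 0 by move=> ks; apply: Zs; rewrite inE ks orbT.
by rewrite ipDr// ipZr// s1// ipBr// Zs ?mem_head// s2// subrr mulr0 addr0.
Qed.

End GaussianFamily.

(** * The CM property and the dynamic model *)

Section CoordinateSpan.
Context dd (T : measurableType dd) (R : realType) (N d : nat).
Variable x : 'I_N.+1 -> T -> 'cV[R]_d.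
Implicit Types (a b : 'I_N.+1 -> 'rV[R]_d) (K : set 'I_N.+1).

Definition lincomb a (w : T) : R := \sum_k (a k *m x k w) 0 0.

(** Coefficients are indexed by all of ['I_N.+1] and vanish outside [K], so that spans over
    different [K] share one type of coefficients. *)
Definition span K : set (T -> R) :=
  [set L | exists a, (forall k, ~ K k -> a k = 0) /\ L = lincomb a].

Definition coord k (i : 'I_d) (w : T) : R := x k w i 0.

Lemma linear_span K : linear_family (span K).
Proof.
split.
- exists (fun=> 0); split => //; apply/funext => w; rewrite /lincomb big1// => k _.
  by rewrite mul0mx mxE.
- move=> c _ [a [Ka ->]]; exists (fun k => c *: a k); split.
    by move=> k /Ka ->; rewrite scaler0.
  apply/funext => w; rewrite /lincomb mulr_sumr; apply: eq_bigr => k _.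
  by rewrite -scalemxAl [RHS]mxE.
- move=> _ _ [a [Ka ->]] [b [Kb ->]]; exists (fun k => a k + b k); split.
    by move=> k Kk; rewrite Ka// Kb// addr0.
  apply/funext => w; rewrite /lincomb -big_split; apply: eq_bigr => k _.
  by rewrite mulmxDl [RHS]mxE.
Qed.

Lemma spanS K K' : K `<=` K' -> span K `<=` span K'.
Proof.
by move=> KK' L [a [Ka ->]]; exists a; split=> // k nK'k; apply: Ka => /KK'.
Qed.

Lemma span_mulmx K k (a : 'rV[R]_d) : K k -> span K (fun w => (a *m x k w) 0 0).
Proof.
move=> Kk; exists (fun l => if l == k then a else 0); split.
  by move=> l nKl; case: eqP => // lk; rewrite lk in nKl.
apply/funext => w; rewrite /lincomb (bigD1 k)//= eqxx big1 ?addr0// => l /negbTE ->.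
by rewrite mul0mx mxE.
Qed.

Lemma span_coord K k i : K k -> span K (coord k i).
Proof.
move=> Kk; have := @span_mulmx K k (delta_mx 0 i) Kk.
by congr (span K _); apply/funext => w; rewrite -rowE mxE.
Qed.

Lemma lincomb_coord a : lincomb a = fun w =>
  \sum_(p <- enum {: 'I_N.+1 * 'I_d}) a p.1 0 p.2 * coord p.1 p.2 w.
Proof.
apply/funext => w; rewrite /lincomb big_enum -(pair_bigA _ (fun k i => a k 0 i * coord k i w))/=.
by apply: eq_bigr => k _; rewrite mxE.
Qed.

End CoordinateSpan.

Section SigmaSeq.
Context dd (T : measurableType dd) (R : realType) (N d : nat).
Variable x : 'I_N.+1 -> T -> 'cV[R]_d.

(** Passes from sigma-fields generated by coordinates to those of linear families, to which the
    character arguments apply. *)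
Lemma sigma_seq_span (K : set 'I_N.+1) : sigma_seq x K = sigma_family (span x K).
Proof.
apply/seteqP; split.
  apply: sub_sigma_algebra2 => _ [k [i [B [Kk mB ->]]]].
  by exists (coord x k i), B; split=> //; exact: span_coord.
apply: smallest_sub; first exact: smallest_sigma_algebra.
move=> _ [_ [B [[a [Ka ->]] mB ->]]]; rewrite /sigma_seq; set gens := (X in <<s X >>).
have : measurable_fun setT (lincomb x a : g_sigma_algebraType gens -> R).
  rewrite lincomb_coord; apply: measurable_sum => -[k i] /=.
  have [Kk|nKk] := pselect (K k); last first.
    by rewrite Ka//; under eq_fun do rewrite mxE mul0r; exact: measurable_cst.
  apply: measurable_funM; first exact: measurable_cst.
  move=> _ E mE; rewrite setTI; apply: sub_sigma_algebra.
  by exists k, i, E.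
by move=> /(_ measurableT B mB); rewrite setTI.
Qed.

End SigmaSeq.

(** * The two implications for a nonsingular Gaussian sequence *)

Section Main.
Context dd (T : measurableType dd) (R : realType) (P : probability T R) (N d : nat).
Variable x : 'I_N.+1 -> T -> 'cV[R]_d.
Hypotheses (x_gauss : gaussian_seq P x) (x_mean : zero_mean_seq P x).
Hypothesis x_nonsing : nonsingular_seq P x.

Notation H := (span x setT).
Notation ip := (ip P).
Notation coord := (coord x).

Lemma lincomb_stack (a : 'I_N.+1 -> 'rV[R]_d) w :
  lincomb x a w = (\mxrow_k a k *m stack x w) 0 0.
Proof. by rewrite /stack mul_mxrow_mxcol summxE. Qed.

Lemma gaussian_span L : H L -> gaussian_rv P L.
Proof.
move=> [a [_ ->]]; have := x_gauss (\mxrow_k a k).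
by congr (gaussian_rv P _); apply/funext => w; rewrite lincomb_stack.
Qed.

Lemma mean_span L : H L -> \int[P]_w L w = 0.
Proof.
have ic k i : P.-integrable setT (EFin \o coord k i).
  by apply: (integrable_family gaussian_span); exact: span_coord.
move=> [a [_ ->]]; rewrite lincomb_coord Rintegral_sum => [|p].
  rewrite big1// => p _; rewrite RintegralZl//.
  have /matrixP /(_ p.2 0) := x_mean p.1; rewrite !mxE unlock => e.
  by rewrite [X in _ * X]e mulr0.
exact: (@integrableZl _ _ _ _ _ measurableT (a p.1 0 p.2) _ (ic p.1 p.2)).
Qed.

Lemma ip_span0 K X L : H X -> (forall k i, K k -> ip X (coord k i) = 0) ->
  span x K L -> ip X L = 0.
Proof.
move=> HX Xc [a [Ka ->]]; rewrite lincomb_coord (ip_sumr (linear_span x setT) gaussian_span)//.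
  rewrite big1// => -[k i] _ /=; have [Kk|nKk] := pselect (K k).
    by rewrite Xc ?mulr0.
  by rewrite Ka// mxE mul0r.
by move=> p; exact: span_coord.
Qed.

Lemma projection_span K X : H X -> exists Y, span x K Y /\
  forall L, span x K L -> ip (fun w => X w - Y w) L = 0.
Proof.
move=> HX.
have KH : span x K `<=` H by exact: spanS.
have Kc (p : 'I_N.+1 * 'I_d) : p \in [seq p <- enum {: 'I_N.+1 * 'I_d} | `[< K p.1 >]] ->
    span x K (coord p.1 p.2).
  by rewrite mem_filter => /andP[/asboolP Kp _]; exact: span_coord.
have [Y [KY o _]] := projection_exists (linear_span x setT) gaussian_span
  (v := fun p : 'I_N.+1 * 'I_d => coord p.1 p.2) (linear_span x K) KH Kc HX.
exists Y; split=> // L; apply: ip_span0.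
  by apply: (linear_familyB (linear_span x setT)) => //; exact: KH.
move=> k i Kk; apply: (o (k, i)).
by rewrite mem_filter mem_enum andbT; exact/asboolP.
Qed.

Lemma expectation_span X : H X -> fine 'E_P[X] = 0.
Proof. by move=> /mean_span; rewrite unlock. Qed.

Lemma covariance_span X Y : H X -> H Y -> fine (covariance P X Y) = ip X Y.
Proof.
move=> HX HY; rewrite [in LHS]unlock (expectation_span HX) (expectation_span HY).
rewrite unlock; apply: eq_Rintegral => w _.
have -> : ((X \- cst 0) * (Y \- cst 0)) w = (X w - 0) * (Y w - 0) by [].
by rewrite !subr0.
Qed.

Lemma expect_outer (m n : nat) (X : T -> 'cV[R]_m) (Y : T -> 'cV[R]_n) i j :
  expect_mx P (fun w => X w *m (Y w)^T) i j = ip (fun w => X w i 0) (fun w => Y w j 0).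
Proof.
rewrite mxE unlock; apply: eq_Rintegral => w _.
by rewrite mxE big_ord1 mxE.
Qed.

(** A combination of zero norm is orthogonal to every coordinate, so its coefficient row annihilates
    the covariance matrix of the stack, which is invertible. *)
Lemma lincomb_eq0 a : ip (lincomb x a) (lincomb x a) = 0 -> forall k, a k = 0.
Proof.
move=> a0 k; have Ha : H (lincomb x a) by exists a; split=> // l /(_ I).
pose s q w := stack x w q 0.
have Hs q : H (s q).
  have -> : s q = coord (tagnat.sig1 q) (tagnat.sig2 q) by apply/funext => w; rewrite /s /stack !mxE.
  exact: span_coord.
have cov0 : \mxrow_k a k *m cov_mx P (stack x) (stack x) = 0.
  apply/rowP => q; rewrite mxE [RHS]mxE.
  rewrite -[RHS](ip_eq0 (linear_span x setT) gaussian_span Ha (Hs q) a0).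
  have -> : lincomb x a = fun w => \sum_(p <- enum 'I_(\sum_(k < N.+1) d)) (\mxrow_k a k) 0 p * s p w.
    by apply/funext => w; rewrite lincomb_stack mxE big_enum.
  rewrite ipC (ip_sumr (linear_span x setT) gaussian_span)// big_enum.
  apply: eq_bigr => p _; congr (_ * _).
  by rewrite ipC [LHS]mxE; exact: covariance_span (Hs p) (Hs q).
have /eqP := cov0; rewrite -[0](mul0mx _ (cov_mx P (stack x) (stack x))).
move=> /eqP /(can_inj (mulmxK x_nonsing)) e.
by have := congr1 (fun A => submxrow A k) e; rewrite mxrowK submxrow0.
Qed.

(** Conditional independence makes [coord k i] orthogonal to the residual of [coord l i']. Since
    each residual is orthogonal to the span of [(x_j, x_c)], the residual can be moved from one
    factor to the other. *)
Lemma CM_orthogonal (c k j l : 'I_N.+1) i i' Y : CM P c x ->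
  (j < k)%N -> k != c -> (l < j)%N -> l != c -> span x [set j; c] Y ->
  (forall L, span x [set j; c] L -> ip (fun w => coord k i w - Y w) L = 0) ->
  ip (fun w => coord k i w - Y w) (coord l i') = 0.
Proof.
move=> CMx jk kc lj lc VY oY; set V := span x [set j; c] in VY oY *.
have HB := linear_familyB (linear_span x setT).
have VH : V `<=` H by exact: spanS.
have Hk : H (coord k i) by exact: span_coord.
have Hl : H (coord l i') by exact: span_coord.
have [b [Vb ob]] := projection_span [set j; c] Hl.
have Hb := VH _ Vb; have HY := VH _ VY.
have := cond_indep_orthogonal (linear_span x setT) gaussian_span mean_span
  (linear_span x [set j; c]) VH Hk Hl Vb ob.
rewrite -sigma_seq_span => /(_ _)/wrap[].
  move=> B B' mB mB'; apply: CMx; apply: sub_sigma_algebra.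
    by exists k, i, B; split=> //; split=> //; exact/eqP.
  by exists l, i', B'; split=> //; split=> //; exact/eqP.
have e1 := ob _ VY; have e2 := oY _ Vb.
have Hlb : H (fun w => coord l i' w - b w) by exact: HB.
have Hky : H (fun w => coord k i w - Y w) by exact: HB.
move=> e3.
have -> : coord l i' = fun w => (coord l i' w - b w) + b w.
  by apply/funext => w; rewrite subrK.
rewrite (ipDr gaussian_span)// e2 addr0 (ipBl (linear_span x setT) gaussian_span)//.
by rewrite e3 [X in _ - X]ipC e1 subrr.
Qed.


Lemma CM_has_model (c : 'I_N.+1) : c = ord0 \/ c = ord_max -> CM P c x ->
  exists (G : 'I_N.+1 -> 'I_N.+1 -> 'M[R]_d) (Q : 'I_N.+1 -> 'M[R]_d)
         (e : 'I_N.+1 -> T -> 'cV[R]_d),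
    white_gaussian_seq P Q e /\ CM_model c G x e.
Proof.
move=> c_0N CMx.
have linH := linear_span x setT.
have HB := linear_familyB linH.
have Hc k i : H (coord k i) by exact: span_coord.
(* The indices on which [x_k] is regressed: [k - 1] and [c] in general, [c] alone when [k = 0] or
   [k = c + 1]. *)
pose Kp (k : 'I_N.+1) := [set l : 'I_N.+1 | l.+1 = k :> nat \/ l = c].
have /choice[A Aprop] (p : 'I_N.+1 * 'I_d) : exists a, (forall l, ~ Kp p.1 l -> a l = 0) /\
    forall L, span x (Kp p.1) L -> ip (fun w => coord p.1 p.2 w - lincomb x a w) L = 0.
  by have [_ [[a [Ka ->]] o]] := projection_span (Kp p.1) (Hc p.1 p.2); exists a.
(* The row of [c] is set to zero, which makes [e c = x c]. *)
pose g k l : 'M[R]_d := if k == c then 0 else \matrix_(i, j) A (k, i) l 0 j.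
have g0 k l : ~ Kp k l -> g k l = 0.
  move=> nK; rewrite /g; case: eqP => // _; apply/matrixP => i j.
  by rewrite mxE (Aprop (k, i)).1// !mxE.
have gc l : g c l = 0 by rewrite /g eqxx.
pose e k w : 'cV[R]_d := x k w - \sum_l g k l *m x l w.
pose ec k i w := e k w i 0.
pose Y k i := lincomb x (fun l => row i (g k l)).
have ecE k i : ec k i = fun w => coord k i w - Y k i w.
  apply/funext => w; rewrite /ec /e /Y /lincomb mxE; congr (_ + _).
  rewrite mxE summxE; congr (- _); apply: eq_bigr => l _.
  by rewrite -row_mul [RHS]mxE.
have YA k i : k != c -> Y k i = lincomb x (A (k, i)).
  move=> kc; congr lincomb; apply/funext => l; apply/rowP => j.
  by rewrite /g (negbTE kc) !mxE.
have HY k i : H (Y k i).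
  by exists (fun l => row i (g k l)); split=> // l /(_ I).
have Hec k i : H (ec k i) by rewrite ecE; exact: HB.
(* The noise is orthogonal to its regressors by construction, and to the other earlier states by the
   CM property at [j = k - 1]. *)
have ortho (k l : 'I_N.+1) i i' : k != c -> (l < k)%N \/ l = c -> ip (ec k i) (coord l i') = 0.
  move=> kc lk; rewrite ecE YA//.
  have [Kl|nKl] := pselect (Kp k l).
    by apply: (Aprop (k, i)).2; exact: span_coord.
  have lc : l != c by apply/eqP => lc; apply: nKl; right.
  case: lk => [lk|/eqP]; last by rewrite (negbTE lc).
  have k0 : (0 < k)%N by exact: leq_ltn_trans lk.
  have jN : (k.-1 < N.+1)%N by rewrite (leq_ltn_trans (leq_pred _)).
  pose j := Ordinal jN; have jk : j.+1 = k by rewrite /= prednK.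
  have KpE : Kp k = [set j; c].
    apply/seteqP; split=> m /=.
      by case=> [mk|->]; [left; apply: val_inj; rewrite /= -mk|right].
    by case=> ->; [left|right].
  have lj : (l < j)%N.
    rewrite ltn_neqAle -ltnS jk lk andbT; apply/eqP => lj; apply: nKl; left.
    by rewrite lj.
  apply: (CM_orthogonal (c := c) (j := j)) => //.
  - by rewrite -jk.
  - by rewrite -KpE; exists (A (k, i)); split=> // m; exact: (Aprop (k, i)).1.
  - by rewrite -KpE; exact: (Aprop (k, i)).2.
(* [e l] is a combination of [x_l] and its regressors, all of which are orthogonal to [e k]. *)
have white1 (k l : 'I_N.+1) i i' : k != c -> (l < k)%N \/ l = c -> ip (ec k i) (ec l i') = 0.
  move=> kc lk; rewrite [ec l i']ecE (ipBr linH gaussian_span)// ortho// sub0r.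
  apply/eqP; rewrite oppr_eq0; apply/eqP.
  apply: (@ip_span0 [set m : 'I_N.+1 | (m < k)%N \/ m = c]) => //.
    by move=> m i'' Km; exact: ortho.
  exists (fun m => row i' (g l m)); split=> // m nKm.
  have [->|lc] := eqVneq l c; first by rewrite gc row0.
  rewrite g0 ?row0// => -[ml|mc]; apply: nKm; [left|by right].
  case: lk => [lk|/eqP]; last by rewrite (negbTE lc).
  by rewrite (ltn_trans _ lk)// -ml.
have white k l i i' : k != l -> ip (ec k i) (ec l i') = 0.
  move=> kl; have [kc|kc] := eqVneq k c.
    by rewrite ipC white1//; [rewrite -kc eq_sym|right].
  have [lc|lc] := eqVneq l c; first by rewrite white1//; right.
  have : (k < l)%N || (l < k)%N by rewrite -neq_ltn; exact: kl.
  case/orP => h; first by rewrite ipC white1//; left.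
  by rewrite white1//; left.
pose Q k := expect_mx P (fun w => e k w *m (e k w)^T).
(* For [k = c + 1] the model uses [G k c] twice. *)
pose G (k l : 'I_N.+1) := if (k == c.+1 :> nat) then 2^-1 *: g k l else g k l.
exists G, Q, e; split; split.
- move=> a; apply: gaussian_span.
  have -> : (fun w => (a *m stack e w) 0 0) = fun w =>
      \sum_(p <- enum 'I_(\sum_(k < N.+1) d)) a 0 p * ec (tagnat.sig1 p) (tagnat.sig2 p) w.
    by apply/funext => w; rewrite mxE big_enum; apply: eq_bigr => p _; rewrite [stack e w p 0]mxE.
  apply: linear_family_sum => // p.
  by case: linH => _ HZ _; exact: HZ.
- move=> k; apply/matrixP => i j; rewrite !mxE ord1.
  exact: expectation_span (Hec k i).
- move=> k j kj; apply/matrixP => i i'; rewrite expect_outer mxE.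
  exact: white.
- by [].
(* If [v] annihilates [Q k], then [v e_k] has zero norm, so its coefficients [b] on the sequence
   vanish; the one at [k] is [v], because [g k k = 0]. *)
- move=> k; rewrite -row_free_unit; apply: inj_row_free => v vQ.
  pose b l := (if l == k then v else 0) - v *m g k l.
  have bE : lincomb x b = fun w => \sum_(i <- enum 'I_d) v 0 i * ec k i w.
    apply/funext => w; rewrite big_enum /=.
    transitivity ((v *m e k w) 0 0); last by rewrite mxE.
    rewrite /e mulmxBr mulmx_sumr [RHS]mxE [X in _ = _ + X]mxE summxE /lincomb.
    under eq_bigr do rewrite mulmxBl mxE [X in _ + X]mxE -mulmxA.
    rewrite big_split /= [X in X + _](bigD1 k)//= eqxx big1 ?addr0; last first.
      by move=> l /negbTE ->; rewrite mul0mx mxE.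
    by rewrite sumrN.
  have Hb : H (lincomb x b) by exists b; split=> // l /(_ I).
  have b_ec i' : ip (lincomb x b) (ec k i') = 0.
    rewrite ipC bE (ip_sumr linH gaussian_span)// big_enum.
    have := congr1 (fun M : 'rV_d => M 0 i') vQ; rewrite mxE [in RHS]mxE => vQ0; rewrite -[RHS]vQ0.
    by apply: eq_bigr => i _; rewrite expect_outer ipC.
  have : ip (lincomb x b) (lincomb x b) = 0.
    rewrite {2}bE (ip_sumr linH gaussian_span)// big1// => i _.
    by rewrite b_ec mulr0.
  move=> /lincomb_eq0 /(_ k); rewrite /b eqxx.
  have -> : g k k = 0.
    have [->|kc] := eqVneq k c; first exact: gc.
    by apply: g0 => -[/eqP|/eqP]; [rewrite -[eqbRHS]addn0 -addn1 eqn_add2l|exact/negP].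
  by rewrite mulmx0 subr0.
- move=> k j kj kc w; rewrite /e addrC addrAC -addrA -[LHS]addr0; congr (_ + _).
  apply/esym/eqP; rewrite subr_eq0; apply/eqP.
  have [jc|jc] := eqVneq j c.
    rewrite (bigD1 c)//= big1 ?addr0; last first.
      move=> l lc; rewrite g0 ?mul0mx// => -[lk|/eqP]; last by rewrite (negbTE lc).
      move/negP: lc; apply; rewrite -jc; apply/eqP/val_inj/succn_inj.
      by rewrite /= -kj.
    rewrite /G kj jc eqxx -!scalemxAl -scalerDl.
    by rewrite (_ : 2^-1 + 2^-1 = 1 :> R) ?scale1r//; field.
  have kc1 : (k == c.+1 :> nat) = false.
    by rewrite kj eqSS; apply/negbTE; exact: jc.
  rewrite /G kc1 (bigD1 j)//= (bigD1 c)/=; last by rewrite eq_sym.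
  rewrite big1 ?addr0// => l /andP[lj lc]; rewrite g0 ?mul0mx// => -[lk|/eqP].
    move/negP: lj; apply; apply/eqP/val_inj/succn_inj.
    by rewrite /= -kj.
  by rewrite (negbTE lc).
- by move=> w; rewrite /e big1 ?subr0// => l _; rewrite gc mul0mx.
- move=> cN w; rewrite -cN /e /G /=.
  (* The indices 0 and [c] coincide when [N = 0]; the coefficient is then zero and the equation
     reads [x_0 = e_0]. *)
  have [c0|c0] := eqVneq ord0 c.
    have g00 l : g ord0 l = 0 by rewrite c0.
    by rewrite g00 mul0mx add0r big1 ?subr0// => l _; rewrite g00 mul0mx.
  rewrite (bigD1 c)//= big1 ?addr0 ?subrKC//; last first.
    by move=> l lc; rewrite g0 ?mul0mx// => -[//|/eqP]; rewrite (negbTE lc).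
Qed.


Lemma model_CM (c : 'I_N.+1) (G : 'I_N.+1 -> 'I_N.+1 -> 'M[R]_d) (Q : 'I_N.+1 -> 'M[R]_d)
    (e : 'I_N.+1 -> T -> 'cV[R]_d) : c = ord0 \/ c = ord_max ->
  white_gaussian_seq P Q e -> CM_model c G x e -> CM P c x.
Proof.
move=> c_0N [_ _ white _ _] [xk xc x0].
have linH := linear_span x setT; have [_ HZ HD] := linH.
have HB := linear_familyB linH.
have Hc k i : H (coord k i) by exact: span_coord.
pose ec k i w := e k w i 0.
have ec_white k l i i' : k != l -> ip (ec k i) (ec l i') = 0.
  by move=> /white /matrixP /(_ i i'); rewrite expect_outer mxE.
have ecc i : ec c i = coord c i by apply/funext => w; rewrite /coord xc.
(* A uniform form of the model. For [k = 0], where [c = N], the only regressor is [x_c], encoded by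
   [j = c] with [G1 = 0]. *)
have rel (k : 'I_N.+1) : k != c -> exists (j : 'I_N.+1) (G1 G2 : 'M[R]_d),
    (j.+1 = k :> nat \/ j = c) /\ forall w, x k w = G1 *m x j w + G2 *m x c w + e k w.
  move=> kc; have [k0|k0] := posnP k; last first.
    have jN : (k.-1 < N.+1)%N by rewrite (leq_ltn_trans (leq_pred _)).
    have jk : k = (Ordinal jN).+1 :> nat by rewrite /= prednK.
    by exists (Ordinal jN), (G k (Ordinal jN)), (G k c); split; [left|exact: xk].
  have k0' : k = ord0 by exact: val_inj.
  case: c_0N => [c0|cN]; first by rewrite k0' c0 eqxx in kc.
  exists c, 0, (G ord0 ord_max); split; first by right.
  by move=> w; rewrite mul0mx add0r k0' cN; exact: x0.
pose comb (G1 : 'M[R]_d) j i w := \sum_(m <- enum 'I_d) G1 i m * coord j m w.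
have Hcomb G1 j i : H (comb G1 j i).
  by apply: linear_family_sum => // m; exact: HZ.
have combE G1 j i w : (G1 *m x j w) i 0 = comb G1 j i w by rewrite /comb big_enum mxE.
have Hec k i : H (ec k i).
  have [->|kc] := eqVneq k c; first by rewrite ecc.
  have [j [G1 [G2 [_ E]]]] := rel k kc.
  have -> : ec k i = fun w => coord k i w - (comb G1 j i w + comb G2 c i w).
    by apply/funext => w; rewrite /coord E 2!mxE !combE /ec; ring.
  by apply: HB => //; exact: HD.
(* The induction step shared by the two recursions below: over the past for the noise, over the
   future for the residual. *)
have step (Z : T -> R) (k j : 'I_N.+1) G1 G2 i : H Z ->
    (forall w, x k w = G1 *m x j w + G2 *m x c w + e k w) ->
    (forall m, ip Z (coord j m) = 0) -> (forall m, ip Z (coord c m) = 0) ->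
    ip Z (ec k i) = 0 -> ip Z (coord k i) = 0.
  move=> HZ' E oj oc oe.
  have -> : coord k i = fun w => comb G1 j i w + comb G2 c i w + ec k i w.
    by apply/funext => w; rewrite /coord E 2!mxE !combE.
  rewrite !(ipDr gaussian_span)//; last exact: HD.
  rewrite oe addr0 !(ip_sumr linH gaussian_span)// !big1 ?addr0// => m _.
    by rewrite oc mulr0.
  by rewrite oj mulr0.
(* Strong induction on [l]: unrolling the model builds [x_l] from [x_c] and from noises of index
   below [k]. *)
have noise_past (k l : 'I_N.+1) i i' : k != c -> (l < k)%N \/ l = c ->
    ip (ec k i) (coord l i') = 0.
  move=> kc; have oc m : ip (ec k i) (coord c m) = 0 by rewrite -ecc; exact: ec_white.
  have [n] := ubnP l; elim: n l i' => // n IH l i' ln lk.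
  have [->//|lc] := eqVneq l c.
  case: lk => [lk|/eqP]; last by rewrite (negbTE lc).
  have [j [G1 [G2 [jl E]]]] := rel l lc.
  apply: (step _ _ j G1 G2) => //; last first.
    by apply: ec_white; rewrite neq_ltn lk orbT.
  move=> m; case: jl => [jl|->//]; apply: IH.
    by rewrite -ltnS jl.
  by left; rewrite (ltn_trans _ lk)// -jl.
move=> j A B; rewrite !sigma_seq_span => sA sB.
pose V := span x [set k : 'I_N.+1 | (j <= k)%N \/ k = c].
pose W := span x [set k : 'I_N.+1 | (k <= j)%N \/ k = c].
pose U := span x [set j; c].
have UV : U `<=` V by apply: spanS => k /= [->|->]; [left|right].
have UW : U `<=` W by apply: spanS => k /= [->|->]; [left|right].
have VH : V `<=` H by exact: spanS.
have WH : W `<=` H by exact: spanS.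
have UH : U `<=` H by exact: spanS.
apply: (cond_indep_markov linH gaussian_span mean_span (linear_span _ _) VH UV
  (linear_span _ _) WH UW).
(* The residual [Z] of [w] on the present is orthogonal to every later state, by induction along the
   recursion. *)
- move=> w Ww; have Hw := WH _ Ww.
  have [Y [UY oY]] := projection_span [set j; c] Hw.
  pose Z t := w t - Y t.
  have HY := UH _ UY; have HZ' : H Z by exact: HB.
  have WZ : W Z by apply: (linear_familyB (linear_span _ _)) => //; exact: UW.
  exists Y, Z; split => //; first by apply/funext => t; rewrite /Z subrKC.
  move=> L; apply: ip_span0 => // k.
  have oc m : ip Z (coord c m) = 0 by apply: oY; apply: span_coord; right.
  have oj m : ip Z (coord j m) = 0 by apply: oY; apply: span_coord; left.
  have [n] := ubnP k; elim: n k => // n IH k kn i jk.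
  have [->//|kc] := eqVneq k c.
  case: jk => [|/eqP]; last by rewrite (negbTE kc).
  rewrite leq_eqVlt => /orP[/eqP jk|jk]; first by rewrite -(val_inj jk).
  have [j' [G1 [G2 [j'k E]]]] := rel k kc.
  apply: (step _ _ j' G1 G2) => //.
    move=> m; case: j'k => [j'k|->//]; apply: IH.
      by rewrite -ltnS j'k.
    by left; rewrite -ltnS j'k.
  (* [Z] lies in [W], spanned by the states up to [j] and [x_c]; as [j < k], the noise [e k] is
     orthogonal to all of them. *)
  rewrite ipC; apply: ip_span0 WZ => // l i' [lj|lc]; apply: noise_past => //.
    by left; exact: leq_ltn_trans jk.
  by right.
- apply: sigma_familyS sA; apply: spanS => k /= [jk _].
  by left; exact: ltnW.
- apply: sigma_familyS sB; apply: spanS => k /= [kj _].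
  by left; exact: ltnW.
Qed.

End Main.

Theorem theorem3p4 (disp : measure_display) (T : measurableType disp)
    (R : realType) (P : probability T R) (N d : nat) (c : 'I_N.+1)
    (x : 'I_N.+1 -> T -> 'cV[R]_d)
    (c_0N : c = ord0 \/ c = ord_max)
    (x_gauss : gaussian_seq P x)
    (x_mean : zero_mean_seq P x)
    (x_nonsing : nonsingular_seq P x) :
  CM P c x <->
  exists (G : 'I_N.+1 -> 'I_N.+1 -> 'M[R]_d) (Q : 'I_N.+1 -> 'M[R]_d)
         (e : 'I_N.+1 -> T -> 'cV[R]_d),
    white_gaussian_seq P Q e /\ CM_model c G x e.
Proof.
split; first exact: CM_has_model.
by move=> [G [Q [e [we me]]]]; exact: (model_CM x_gauss x_mean c_0N we me).
Qed.
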